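(* Let $G$ be a bicyclic graph of order $n\geqslant 6$ with $G\notin\{B(n,0),B(n,1),B_n^{(1)},B_n^{3,3}\}$. \begin{itemize} \item[(i)] If $n=6$, then $W(G)<W(B_6^{(1)})<W(B(6,1))=W(B_6^{3,3})<W(B(6,0))$. \item[(ii)] If $n=8$ and $G\ncong B(8,2)$, then $W(G)<W(B(8,2))=W(B_8^{(1)})<W(B(8,1))<W(B_8^{3,3})<W(B(8,0))$. \item[(iii)] If $n\geqslant 7$ and $n\neq 8$, then $W(G)<W(B_n^{(1)})<W(B(n,1))<W(B_n^{3,3})<W(B(n,0))$. \end{itemize}
   Context: All graphs are finite, simple, undirected. A connected graph $G$ is bicyclic if $|E_G|=|V_G|+1$. The Wiener index is $W(G)=\sum_{\{u,v\}\subseteq V_G} d_G(u,v)$. $P_m$ is the path on $m$ vertices, $C_p$ the cycle on $p$ vertices, $K_4^-$ the graph obtained from $K_4$ by deleting one edge (it has two vertices of degree 3 and two of degree 2). $B_n^{(1)}$ is the $n$-vertex graph obtained by identifying an end-vertex of $P_{n-3}$ with a degree-3 vertex of $K_4^-$. For $0\leqslant s\leqslant\lfloor (n-4)/2\rfloor$, $B(n,s)$ is the $n$-vertex graph obtained from $K_4^-$ by attaching a path on $n-s-4$ new vertices to one degree-2 vertex and a path on $s$ new vertices to the other degree-2 vertex (each attached by an edge from the degree-2 vertex to an end-vertex of the path; a path on $0$ vertices means nothing is attached). $B_n^{p,q}$ is the $n$-vertex graph obtained by joining a vertex of $C_p$ and a vertex of a disjoint $C_q$ by a path of length $n-p-q+1$.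 *)

(* Defs.v *)
From HB Require Import structures.
From mathcomp Require Import all_boot.

Set Implicit Arguments.
Unset Strict Implicit.
Unset Printing Implicit Defensive.

Record sgraph := SGraph {
  vertex :> finType;
  adj : rel vertex;
  adj_sym : symmetric adj;
  adj_irr : irreflexive adj
}.

Definition edges (G : sgraph) : {set {set G}} :=
  [set e | [exists x : G, exists y : G, adj x y && (e == [set x; y])]].

Definition connected (G : sgraph) : Prop :=
  0 < #|G| /\ forall x y : G, connect (@adj G) x y.

Definition bicyclic (G : sgraph) : Prop :=
  connected G /\ #|edges G| = #|G| + 1.

Definition iso (G H : sgraph) : Prop :=
  exists f : G -> H, bijective f /\ forall x y : G, adj (f x) (f y) = adj x y.

(* The least length of a walk from u to v.  Such a length is always < #|G|;
   [find] returns the junk value #|G| when u and v are not connected. *)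
Definition dist (G : sgraph) (u v : G) : nat :=
  find (fun k => [exists p : k.-tuple G, path (@adj G) u p && (last u p == v)])
       (iota 0 #|G|).

(* [enum_rank u < enum_rank v] selects each unordered pair exactly once. *)
Definition wiener (G : sgraph) : nat :=
  \sum_(u : G) \sum_(v : G | enum_rank u < enum_rank v) dist u v.

Section OfEdges.
Variables (n : nat) (es : seq (nat * nat)).

Definition of_edges_rel : rel 'I_n :=
  fun x y => (x != y) &&
    (((val x, val y) \in es) || ((val y, val x) \in es)).

Lemma of_edges_sym : symmetric of_edges_rel.
Proof. by move=> x y; rewrite /of_edges_rel eq_sym orbC. Qed.

Lemma of_edges_irr : irreflexive of_edges_rel.
Proof. by move=> x; rewrite /of_edges_rel eqxx. Qed.

(* The graph on {0, ..., n-1} whose edges are the pairs listed in es. *)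
Definition of_edges : sgraph := SGraph of_edges_sym of_edges_irr.
End OfEdges.

(* Edges of the path, respectively of the cycle, visiting the vertices of vs
   in order. *)
Definition path_edges (vs : seq nat) : seq (nat * nat) := zip vs (behead vs).
Definition cycle_edges (vs : seq nat) : seq (nat * nat) := zip vs (rot 1 vs).

(* K_4 minus the edge ad: a and d have degree 2, b and c have degree 3. *)
Definition K4minus_edges (a b c d : nat) : seq (nat * nat) :=
  [:: (a, b); (a, c); (b, c); (b, d); (c, d)].

(* B_n^{(1)}, for n >= 4: the path P_{n-3} on 3, ..., n-1 starts at the
   degree-3 vertex 3 of K_4^-. *)
Definition B1 (n : nat) : sgraph :=
  of_edges n (K4minus_edges 0 2 3 1 ++ path_edges (iota 3 (n - 3))).

(* B(n,s), for s <= (n-4)/2: K_4^- sits on s, ..., s+3, with degree-2 vertices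
   s and s+3; the s new vertices 0, ..., s-1 precede s, and the n-s-4 new
   vertices s+4, ..., n-1 follow s+3. *)
Definition B (n s : nat) : sgraph :=
  of_edges n (K4minus_edges s s.+1 s.+2 s.+3
              ++ path_edges (iota 0 s.+1)
              ++ path_edges (iota s.+3 (n - s - 3))).

(* B_n^{p,q}, for p, q >= 3 and p + q <= n + 1: C_p on 0, ..., p-1, C_q on
   n-q, ..., n-1, and a path of length n-p-q+1 from p-1 to n-q. *)
Definition Bpq (n p q : nat) : sgraph :=
  of_edges n (cycle_edges (iota 0 p)
              ++ path_edges (iota p.-1 (n + 2 - p - q))
              ++ cycle_edges (iota (n - q) q)).

(* Main.v *)
Require Import Defs.
From mathcomp Require Import all_boot zify.

(* Let thr(n) = (n^3 - 19n + 48)/6; all four exceptional graphs have Wiener index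
   larger than thr(n), and every other bicyclic graph of order n >= 6 (except
   B(8,2)) is shown to satisfy W <= thr(n).  Deleting a vertex v that does not
   disconnect G gives W(G) <= W(G - v) + D(v), where D(v), the sum of the distances
   from v, is the sum over k of the number of vertices at distance more than k.

   If v is pendant, induct on n.  The increment of thr is exactly what D(v) can
   contribute, unless v is the far end of B(n,0); if G - v is itself exceptional,
   D(v) is computed from the place where v is attached.

   If no vertex is pendant and there is no cut vertex, all distance layers but the
   first and the last have at least two vertices, so D(v) <= n^2/4 for all v.  If
   there is a cut vertex, the vertices farthest from it on two different sides have
   degree 2 and can be deleted, leaving a connected graph with a cycle, for which
   W is at most its value on a triangle with a pendant path.  Such a v, or a
   neighbour of it, has D(v) small enough unless v is the tip of a triangle hanging
   at one vertex; if this happens on both sides, G is B_n^{3,3}.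

   The base case n = 6 is an enumeration: every connected graph arises from a
   smaller one by adding a vertex. *)

Set Implicit Arguments.
Unset Strict Implicit.
Unset Printing Implicit Defensive.

(** * Distances *)

Lemma dist_le_size (G : sgraph) (u v : G) (p : seq G) :
  path (@adj G) u p -> last u p = v -> dist u v <= size p.
Proof.
move=> up uv; rewrite /dist.
set a := fun k : nat => _.
have ap : a (size p) by apply/existsP; exists (in_tuple p); rewrite /= up uv eqxx.
(* A walk of length [#|G|] or more lies outside the searched range; there the bound holds because
   [find] never exceeds [#|G|]. *)
have [pG|Gp] := ltnP (size p) #|G|; last first.
  by apply: leq_trans Gp; rewrite -[X in _ <= X](size_iota 0) find_size.
rewrite leqNgt; apply/negP => /(before_find 0).
by rewrite nth_iota // add0n ap.
Qed.

Lemma distxx (G : sgraph) (u : G) : dist u u = 0.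
Proof. by apply/eqP; rewrite -leqn0; apply: (@dist_le_size G u u [::]). Qed.

Lemma dist_path (G : sgraph) (u v : G) :
  connect (@adj G) u v ->
  exists p, [/\ path (@adj G) u p, last u p = v & size p = dist u v].
Proof.
(* A walk without repeated vertices is shorter than [#|G|], so [find] does not fall back on its
   default. *)
case/connectP=> p0 /shortenP[p up p_uniq _] ->.
have pG : size p < #|G|.
  by rewrite -[X in X <= _]/(size (u :: p)) -(card_uniqP p_uniq) max_card.
set v0 := last u p; rewrite /dist; set a := fun k : nat => _.
have ha : has a (iota 0 #|G|).
  apply/hasP; exists (size p); first by rewrite mem_iota.
  by apply/existsP; exists (in_tuple p); rewrite /= up eqxx.
have := nth_find 0 ha; rewrite has_find size_iota in ha; rewrite nth_iota //.
by case/existsP=> q /andP[uq /eqP qv]; exists q; rewrite size_tuple.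
Qed.

(* A potential that vanishes at u, is 1-Lipschitz along edges and can always be
   decreased along an edge must be the distance to u. *)
Lemma dist_certificate (G : sgraph) (u : G) (F : G -> nat) :
  F u = 0 -> (forall x y, adj x y -> F y <= (F x).+1) ->
  (forall v, v != u -> exists2 y, adj y v & F y < F v) ->
  forall v, connect (@adj G) u v /\ dist u v = F v.
Proof.
move=> Fu Flip Fdec v.
have up n w : F w <= n -> exists p, [/\ path (@adj G) u p, last u p = w & size p <= n].
  elim: n w => [|n IHn] w Fw; have [->|wu] := eqVneq w u; try by exists [::].
    by have [y _] := Fdec w wu; lia.
  have [y yw Fy] := Fdec w wu; have [|p [up_ py ps]] := IHn y; first by lia.
  by exists (rcons p w); rewrite rcons_path last_rcons size_rcons up_ py.
have low p x : path (@adj G) x p -> F (last x p) <= F x + size p.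
  elim: p x => [|y p IHp] x /=; first by lia.
  by case/andP=> /Flip xy /IHp; lia.
have [p [u_p pv ps]] := up _ v (leqnn _).
have uv : connect (@adj G) u v by apply/connectP; exists p.
split=> //; apply/eqP; rewrite eqn_leq (leq_trans (dist_le_size u_p pv)) //=.
have [q [uq qv <-]] := dist_path uv.
by have := low _ _ uq; rewrite qv Fu.
Qed.

Section ConnectedDistance.
Variables (G : sgraph) (Gc : connected G).
Implicit Types u v x y : G.

Lemma dist_eq0 u v : (dist u v == 0) = (u == v).
Proof.
apply/eqP/eqP => [|->]; last exact: distxx.
by have [p [_ <- <-]] := dist_path (Gc.2 u v); case: p.
Qed.

Lemma dist_gt0 u v : (0 < dist u v) = (u != v).
Proof. by rewrite lt0n dist_eq0. Qed.

Lemma dist_adj u x y : adj x y -> dist u y <= (dist u x).+1.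
Proof.
move=> xy; have [p [up px <-]] := dist_path (Gc.2 u x).
have := @dist_le_size G u y (rcons p y).
by rewrite rcons_path last_rcons size_rcons up px; apply.
Qed.

Lemma dist_parent u v : u != v -> exists2 y, adj y v & dist u v = (dist u y).+1.
Proof.
move=> uv; have [p] := dist_path (Gc.2 u v).
case: (lastP p) => [|q z] [up pv ps]; first by rewrite /= in pv; rewrite pv eqxx in uv.
move: up pv ps; rewrite rcons_path last_rcons size_rcons => /andP[uq qz] zv qs.
subst z; exists (last u q) => //.
apply/eqP; rewrite eqn_leq dist_adj //= -qs ltnS.
exact: dist_le_size.
Qed.

Lemma dist_triangle u v w : dist u w <= dist u v + dist v w.
Proof.
have [p [up pv <-]] := dist_path (Gc.2 u v).
have [q [vq qw <-]] := dist_path (Gc.2 v w).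
by rewrite -size_cat; apply: dist_le_size; rewrite ?cat_path ?last_cat pv ?up.
Qed.

Lemma dist_sym u v : dist u v = dist v u.
Proof.
have le x y : dist x y <= dist y x.
  have [p [yp px <-]] := dist_path (Gc.2 y x).
  have := @dist_le_size G x y (rev (belast y p)).
  rewrite size_rev size_belast; apply.
    rewrite -px rev_path; apply: sub_path yp => a b /=.
    by rewrite adj_sym.
  by case: p px {yp} => //= z p _; rewrite rev_cons last_rcons.
by apply/eqP; rewrite eqn_leq !le.
Qed.

Lemma dist1 u v : (dist u v == 1) = adj u v.
Proof.
apply/idP/idP => [/eqP d1|uv].
  have uv : u != v by rewrite -dist_gt0 d1.
  have [y yv] := dist_parent uv; rewrite d1 => -[/esym/eqP].
  by rewrite dist_eq0 => /eqP ->.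
rewrite eqn_leq dist_gt0; have := dist_adj u uv; rewrite distxx => -> /=.
by apply: contraTneq uv => ->; rewrite adj_irr.
Qed.

Lemma dist_ball u v j : j <= dist u v -> exists w, dist u w = j.
Proof.
move E : (dist u v) => n; elim: n v E => [|n IHn] v E.
  by rewrite leqn0 => /eqP ->; exists v.
rewrite leq_eqVlt => /predU1P[-> | jn]; first by exists v.
have [|y _] := @dist_parent u v; first by rewrite -dist_gt0 E.
by rewrite E => -[/esym Ey]; apply: IHn Ey _.
Qed.

End ConnectedDistance.

Definition dsum (G : sgraph) (u : G) := \sum_(x : G) dist u x.
Definition dsum2 (G : sgraph) := \sum_(u : G) dsum u.

(** Each unordered pair is counted once in each order; ordered pairs keep [enum_rank] out of all
    later distance sums. *)
Lemma wiener_double (G : sgraph) : connected G -> 2 * wiener G = dsum2 G.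
Proof.
move=> Gc; rewrite /wiener /dsum2 /dsum mul2n -addnn.
rewrite {2}(exchange_big_dep predT) //= -big_split; apply: eq_bigr => u _ /=.
rewrite [RHS](bigID (fun v => enum_rank u < enum_rank v)) /=; congr (_ + _).
rewrite [RHS](bigD1 u) ?ltnn //= distxx add0n; apply: eq_big => [v|v _].
  by rewrite -leqNgt ltn_neqAle andbC (inj_eq val_inj) (inj_eq enum_rank_inj).
exact: dist_sym.
Qed.

(** * Degrees and vertex deletion *)

Definition deg (G : sgraph) (x : G) := \sum_(y : G) adj x y.
Definition degsum (G : sgraph) := \sum_(x : G) deg x.

Lemma degE (G : sgraph) (x : G) : deg x = #|[set y | adj x y]|.
Proof. by rewrite cardsE -sum1_card big_mkcond. Qed.

Lemma degsum_edges (G : sgraph) : degsum G = 2 * #|edges G|.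
Proof.
(* Each edge is represented by its endpoints in increasing rank, which makes the map to edges
   injective. *)
pose P := [set p : G * G | adj p.1 p.2 & enum_rank p.1 < enum_rank p.2].
have rank_inj : injective (fun x : G => nat_of_ord (enum_rank x)).
  exact: inj_comp val_inj enum_rank_inj.
have -> : edges G = [set [set p.1; p.2] | p in P].
  apply/setP=> e; rewrite !inE; apply/existsP/imsetP => [[x /existsP[y /andP[xy /eqP->]]]|].
    have [r|r|/rank_inj r] := ltngtP (enum_rank x) (enum_rank y).
    - by exists (x, y); rewrite ?inE ?xy.
    - by exists (y, x); rewrite ?inE /= ?r ?[adj y x]adj_sym ?xy // setUC.
    - by rewrite r adj_irr in xy.
  case=> -[x y]; rewrite inE /= => /andP[xy _] ->.
  by exists x; apply/existsP; exists y; rewrite xy eqxx.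
rewrite card_in_imset; last first.
  move=> [a b] [c d]; rewrite !inE /= => /andP[_ ab] /andP[_ cd] /setP E.
  have := E a; have := E b; rewrite !inE !eqxx orbT /= => /esym bE /esym aE.
  case/orP: aE => /eqP aE; case/orP: bE => /eqP bE; subst => //.
  - by rewrite ltnn in ab.
  - by move: ab cd; lia.
  - by rewrite ltnn in ab.
rewrite -sum1_card (eq_bigl (fun p => predT p.1 && (adj p.1 p.2 && (enum_rank p.1 < enum_rank p.2)))); last first.
  by move=> p; rewrite inE.
rewrite -(pair_big_dep predT (fun x y : G => adj x y && (enum_rank x < enum_rank y)) (fun _ _ => 1)) /=.
rewrite mul2n -addnn {2}(exchange_big_dep predT) //=. rewrite -[RHS]big_split /=.
apply: eq_bigr => x _; rewrite /deg.
rewrite [X in _ = X + _]big_mkcond [X in _ = _ + X]big_mkcond -[RHS]big_split; apply: eq_bigr => y _ /=.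
rewrite [adj y x]adj_sym; case xy: (adj x y) => //=.
have := @rank_inj x y; case: ltngtP => //= r /(_ r) E.
by rewrite E adj_irr in xy.
Qed.

Section Deletion.
Variables (G : sgraph) (v : G).

Definition del_rel : rel {x : G | x != v} := fun x y => adj (val x) (val y).
Lemma del_sym : symmetric del_rel.
Proof. by move=> x y; rewrite /del_rel adj_sym. Qed.
Lemma del_irr : irreflexive del_rel.
Proof. by move=> x; rewrite /del_rel adj_irr. Qed.
Definition del : sgraph := SGraph del_sym del_irr.

Definition undel (x : del) : G := val x.

Lemma adj_del (x y : del) : adj x y = adj (undel x) (undel y).
Proof. by []. Qed.

Lemma undel_inj : injective undel.
Proof. exact: val_inj. Qed.

Lemma undel_neq (x : del) : undel x != v.
Proof. exact: (valP x). Qed.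

Lemma undelP (x : G) : x != v -> exists y, undel y = x.
Proof. by move=> xv; exists (exist _ x xv : del). Qed.

Lemma sum_del (F : G -> nat) : \sum_(x : del) F (undel x) = \sum_(x | x != v) F x.
Proof.
rewrite (reindex_omap undel (fun x => insub x : option del)) => [|x xv].
  by apply: eq_bigl => x; rewrite undel_neq [insub _]valK eqxx.
by rewrite insubT.
Qed.

Lemma card_del : #|del|.+1 = #|G|.
Proof.
rewrite card_sig -cardsT (cardD1 v) inE add1n; congr _.+1.
by apply: eq_card => x; rewrite !inE andbT.
Qed.

Lemma deg_del (x : del) : deg x + adj (undel x) v = deg (undel x).
Proof.
by rewrite /deg [RHS](bigD1 v) //= -(sum_del (fun y => adj (undel x) y : nat)) addnC.
Qed.

Lemma degsum_del : degsum del + 2 * deg v = degsum G.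
Proof.
rewrite {2}/degsum (bigD1 v) //= -(sum_del (@deg G)).
rewrite -(eq_bigr _ (fun x _ => deg_del x)) big_split /= -/(degsum del).
have -> : \sum_(x : del) adj (undel x) v = deg v.
  rewrite (sum_del (fun x => adj x v : nat)) /deg [RHS](bigD1 v) //= adj_irr add0n.
  by apply: eq_bigr => x _; rewrite adj_sym.
by lia.
Qed.

(** [F] acts as a potential: descending along it leads every remaining vertex to [w] without meeting
    [v]. *)
Lemma connected_del (w : G) (F : G -> nat) : w != v ->
  (forall y, y != v -> y != w -> exists y', [/\ adj y' y, y' != v & F y' < F y]) ->
  connected del.
Proof.
move=> wv Fdec; have [w0 w0E] := undelP wv.
have cw (x : del) : connect (@adj del) w0 x.
  have [n] := ubnP (F (undel x)); elim: n x => // n IHn x Fx.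
  have [xw|xw] := eqVneq (undel x) w.
    by rewrite (_ : x = w0) // -(undel_inj (etrans xw (esym w0E))).
  have [y [yx yv Fy]] := Fdec _ (undel_neq x) xw.
  have [y0 y0E] := undelP yv; rewrite -y0E in yx Fy.
  by apply: connect_trans (connect1 (_ : adj y0 x)); [apply: IHn; lia | rewrite adj_del].
split; first by apply/card_gt0P; exists w0.
by move=> x y; apply: connect_trans (cw y); rewrite (sym_connect_sym (@del_sym)).
Qed.
End Deletion.
Arguments sum_del {G v} F.

(** * Distance layers *)

(** Strict decrease down to zero bounds the sum by c 0 + (c 0 - 1) + ... + 1. *)
Lemma tri_sum (c : nat -> nat) N : (forall k, c k.+1 <= (c k).-1) ->
  2 * \sum_(k < N) c k <= c 0 * (c 0).+1.
Proof.
elim: N c => [|N IHN] c cdec; first by rewrite big_ord0; lia.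
rewrite big_ord_recl /=.
have /= := IHN (fun k => c k.+1) (fun k => cdec k.+1).
rewrite (eq_bigr (fun k : 'I_N => c (lift ord0 k))) => [|k _]; last by rewrite lift0.
by have := cdec 0; nia.
Qed.

(** Only the sequence c 0, c 0 - 1, ..., 1 attains the triangular number, and it takes the value 1
    at index c 0 - 1. Excluding it costs at least one. *)
Lemma tri_sum_short (c : nat -> nat) N : (forall k, c k.+1 <= (c k).-1) ->
  0 < c 0 -> c (c 0).-1 = 0 -> 2 * \sum_(k < N) c k + 2 <= c 0 * (c 0).+1.
Proof.
elim: N c => [|N IHN] c cdec c0 cz.
  by rewrite big_ord0; have [c1|c1] := eqVneq (c 0) 1; [rewrite c1 /= in cz|]; nia.
rewrite big_ord_recl /=.
have [c1E|c1E] := eqVneq (c 1) (c 0).-1; last first.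
  have /= := @tri_sum (fun k => c k.+1) N (fun k => cdec k.+1).
  rewrite (eq_bigr (fun k : 'I_N => c (lift ord0 k))) => [|k _]; last by rewrite lift0.
  by have := cdec 0; nia.
have c0_gt1 : 1 < c 0.
  by rewrite ltn_neqAle c0 andbT; apply: contraTneq c0 => E; rewrite -E /= in cz; rewrite cz.
have /= := IHN (fun k => c k.+1) (fun k => cdec k.+1).
rewrite (eq_bigr (fun k : 'I_N => c (lift ord0 k))) => [|k _]; last by rewrite lift0.
have -> : (c 1).-1.+1 = (c 0).-1 by lia.
by move=> /(_ _ cz); nia.
Qed.

(** The worst case is c 0 + (c 0 - 2) + (c 0 - 4) + ..., which is at most (c 0 + 1)^2 / 4. *)
Lemma tri_sum_double (c : nat -> nat) N : (forall k, c k.+1 <= c k - 2) ->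
  4 * \sum_(k < N) c k <= (c 0).+1 ^ 2.
Proof.
elim: N c => [|N IHN] c cdec; first by rewrite big_ord0; lia.
rewrite big_ord_recl /=.
have /= := IHN (fun k => c k.+1) (fun k => cdec k.+1).
rewrite (eq_bigr (fun k : 'I_N => c (lift ord0 k))) => [|k _]; last by rewrite lift0.
by have := cdec 0; nia.
Qed.

(** Counting the vertices beyond radius [k], rather than those at distance [k], turns a sum of
    distances into an unweighted sum over [k]; see [dsum_far]. *)
Definition far (G : sgraph) (u : G) k := #|[set x | k < dist u x]|.

Section Layers.
Variables (G : sgraph) (Gc : connected G).
Implicit Types u v x y : G.

Lemma dist_lt_card u x : dist u x < #|G|.
Proof.
case/connectP: (Gc.2 u x) => p0 /shortenP[p up p_uniq _] ->.
apply: leq_ltn_trans (dist_le_size up erefl) _.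
by rewrite -[X in X <= _]/(size (u :: p)) -(card_uniqP p_uniq) max_card.
Qed.

Lemma far_rec u k : far u k = #|[set x | dist u x == k.+1]| + far u k.+1.
Proof.
rewrite /far -cardsUI [X in _ = _ + X](_ : _ = 0) ?addn0.
  by apply: eq_card => x; rewrite !inE; lia.
by apply: eq_card0 => x; rewrite !inE; lia.
Qed.

Lemma far_dec u k : far u k.+1 <= (far u k).-1.
Proof.
have [->|] := posnP (far u k.+1); first by [].
case/card_gt0P => x; rewrite inE => kx.
have [|y /eqP yk] := @dist_ball _ Gc u x k.+1; first by lia.
have : 0 < #|[set x | dist u x == k.+1]| by apply/card_gt0P; exists y; rewrite inE.
by rewrite (far_rec u k); lia.
Qed.

Lemma far0 u : (far u 0).+1 = #|G|.
Proof.
rewrite /far -cardsT (cardsD1 u [set: G]) inE add1n; congr _.+1.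
by apply: eq_card => x; rewrite !inE dist_gt0 // andbT eq_sym.
Qed.

Lemma far1 u : deg u + far u 1 = far u 0.
Proof.
by rewrite [RHS]far_rec degE; congr (_ + _); apply: eq_card => x; rewrite !inE dist1.
Qed.

Lemma far_eq0 u k : far u k = 0 <-> forall x, dist u x <= k.
Proof.
split=> [/eqP + x|le].
  by rewrite cards_eq0 => /eqP/setP/(_ x); rewrite !inE ltnNge => /negbFE.
by apply: eq_card0 => x; rewrite inE ltnNge le.
Qed.

Lemma dsum_far u N : #|G| <= N -> dsum u = \sum_(k < N) far u k.
Proof.
move=> GN; rewrite /dsum.
transitivity (\sum_(x : G) \sum_(k < N) (k < dist u x)).
  apply: eq_bigr => x _; have := leq_trans (ltnW (dist_lt_card u x)) GN.
  elim: {GN} N => [|N IHN]; first by rewrite big_ord0; lia.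
  rewrite big_ord_recr /= leq_eqVlt => /predU1P[E|dN]; last first.
    by rewrite -IHN //; lia.
  rewrite E ltnSn addn1; congr _.+1.
  rewrite (eq_bigr (fun=> 1)) ?sum1_card ?card_ord // => k _.
  by rewrite ltnS ltnW.
rewrite exchange_big; apply: eq_bigr => k _.
by rewrite /far -sum1_card [RHS]big_mkcond; apply: eq_bigr => x _; rewrite inE; case: ltnP.
Qed.

Lemma dsum_far3 u : exists N, dsum u = far u 0 + (far u 1 + \sum_(k < N) far u (k + 2)).
Proof.
exists #|G|; rewrite (@dsum_far u #|G|.+2) ?leqW // !big_ord_recl.
by congr (_ + (_ + _)); apply: eq_bigr => k _; rewrite addn2.
Qed.

Lemma dsum_far2 u : exists N, dsum u = far u 0 + \sum_(k < N) far u (k + 1).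
Proof.
exists #|G|; rewrite (@dsum_far u #|G|.+1) // !big_ord_recl.
by congr (_ + _); apply: eq_bigr => k _; rewrite addn1.
Qed.

Lemma dsum_le u : 2 * dsum u + #|G| <= #|G| ^ 2.
Proof.
rewrite (@dsum_far u #|G|) //.
by have := tri_sum #|G| (far_dec u); have := far0 u; nia.
Qed.

(** Here far u 0 = n - 1 and far u 1 <= n - 1 - d; from there on [tri_sum] applies. *)
Lemma dsum_le_deg u d : d <= deg u -> d < #|G| ->
  2 * dsum u <= 2 * #|G|.-1 + (#|G|.-1 - d) * (#|G| - d).
Proof.
have [N ->] := dsum_far2 u => du dG.
have /= := @tri_sum (fun k => far u (k + 1)) N (fun k => far_dec u (k + 1)).
have := far0 u; have := far1 u.
rewrite add0n mulnDr => f1 f0 tri.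
rewrite -f0 /= in dG *.
apply: leq_add => //; apply: leq_trans tri _; apply: leq_mul; lia.
Qed.

(** Degree at least 2 gives far u 1 <= n - 3. Reaching the triangular number of n - 3 would need a
    vertex at distance n - 2, which the eccentricity bound rules out, saving one. *)
Lemma dsum_le_deg2_short u : 2 <= deg u -> 4 <= #|G| -> (forall x, dist u x <= #|G| - 3) ->
  2 * dsum u + 3 * #|G| <= #|G| ^ 2 + 2.
Proof.
have [N ->] := dsum_far2 u => du G4 /far_eq0 fz.
have /= := @tri_sum (fun k => far u (k + 1)) N (fun k => far_dec u (k + 1)).
have /= := @tri_sum_short (fun k => far u (k + 1)) N (fun k => far_dec u (k + 1)).
have := far0 u; have := far1 u; rewrite add0n => f1 f0.
have [m mE] : exists m, #|G| = m + 4 by exists (#|G| - 4); rewrite subnK.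
rewrite mE in f0 fz *; have [E|NE] := eqVneq (far u 1) (m + 1); last first.
  by move=> _; have := @leq_mul (far u 1) m (far u 1).+1 m.+1; nia.
rewrite E addn1 /= -addnBA // in fz *.
by move=> /(_ _ fz); nia.
Qed.

(** At least two vertices in each of the layers 1 and 2 bound the sum by (n - 1) + (n - 3) plus the
    triangular number of n - 5; the eccentricity bound saves one more. *)
Lemma dsum_le_two_layers u : 2 <= deg u -> far u 2 + 2 <= far u 1 -> 6 <= #|G| ->
  (forall x, dist u x <= #|G| - 4) -> 2 * dsum u + 5 * #|G| <= #|G| ^ 2 + 10.
Proof.
have [N ->] := dsum_far3 u => du f2 G4 /far_eq0 fz.
have /= := @tri_sum (fun k => far u (k + 2)) N (fun k => far_dec u (k + 2)).
have /= := @tri_sum_short (fun k => far u (k + 2)) N (fun k => far_dec u (k + 2)).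
have := far0 u; have := far1 u; rewrite add0n => f1 f0.
have [m mE] : exists m, #|G| = m + 6 by exists (#|G| - 6); rewrite subnK.
rewrite mE in f0 fz *; have [E|NE] := eqVneq (far u 2) (m + 1); last first.
  by move=> _; have := @leq_mul (far u 2) m (far u 2).+1 m.+1; nia.
rewrite E addn1 /= -addnBA // in fz *.
by move=> /(_ _ fz); nia.
Qed.

(** The sequence [far u] starts at n - 1 and drops by at least two at each step until it
    vanishes. *)
Lemma dsum_le_double u :
  (forall k, far u k.+1 != 0 -> 2 <= #|[set x | dist u x == k.+1]|) ->
  4 * dsum u <= #|G| ^ 2.
Proof.
move=> dbl; rewrite (@dsum_far u #|G|) //.
have := @tri_sum_double (far u) #|G|; have := far0 u => <-; apply => k.
have [-> //|nz] := eqVneq (far u k.+1) 0.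
by have := dbl _ nz; rewrite (far_rec u k); lia.
Qed.

End Layers.

(** * Distances after deleting a vertex *)

Section DeletionDistance.
Variables (G : sgraph) (Gc : connected G) (v : G).

(** [v] is a local maximum of the distance from [w], so no shortest path from [w] continues beyond
    [v]. *)
Lemma connected_del_far (w : G) : w != v -> (forall y, adj v y -> dist w y <= dist w v) ->
  connected (del v).
Proof.
move=> wv vfar; apply: (@connected_del _ _ w (dist w)) => // y yv yw.
rewrite eq_sym in yw; have [y' y'y E] := dist_parent Gc yw.
exists y'; split=> //; last by lia.
by apply: contraTneq y'y => y'v; apply/negP; rewrite y'v => /vfar; rewrite E y'v; lia.
Qed.

Lemma deg1P : deg v = 1 -> exists u, forall x, adj v x = (x == u).
Proof.
rewrite degE => /eqP/cards1P[u /setP uE]; exists u => x.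
by have := uE x; rewrite !inE.
Qed.

Lemma connected_del_pendant : deg v = 1 -> connected (del v).
Proof.
case/deg1P=> u uE; apply: (@connected_del_far u) => [|y].
  by apply/eqP => uv; have := uE u; rewrite uv adj_irr eqxx.
by rewrite uE => /eqP->; rewrite distxx.
Qed.

Hypothesis dc : connected (del v).

Lemma dist_del (x y : del v) : dist (undel x) (undel y) <= dist x y.
Proof.
have [p [xp <- <-]] := dist_path (dc.2 x y).
have := @dist_le_size G (undel x) (undel (last x p)) (map (@undel _ v) p).
by rewrite size_map; apply; rewrite ?last_map // path_map.
Qed.

(** Pairs avoiding [v] do not get closer when [v] is deleted, and each pair containing [v] occurs in
    both orders. *)
Lemma dsum2_del : dsum2 G <= dsum2 (del v) + 2 * dsum v.
Proof.
have sum_v : \sum_(x | x != v) dist x v = dsum v.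
  rewrite /dsum [RHS](bigD1 v) //= distxx add0n.
  by apply: eq_bigr => x _; apply: dist_sym.
have : \sum_(x | x != v) \sum_(y | y != v) dist x y <= dsum2 (del v).
  rewrite -(sum_del (fun x => \sum_(y | y != v) dist x y)) /dsum2.
  apply: leq_sum => x _; rewrite -(sum_del (dist (undel x))).
  by apply: leq_sum => y _; apply: dist_del.
have -> : dsum2 G = dsum v + \sum_(x | x != v) (dist x v + \sum_(y | y != v) dist x y).
  rewrite /dsum2 (bigD1 v) //=; congr (_ + _); apply: eq_bigr => x _.
  by rewrite /dsum (bigD1 v).
by rewrite big_split /= sum_v; lia.
Qed.

Lemma dsum_pendant (u : del v) : adj v (undel u) -> dsum v <= #|del v| + dsum u.
Proof.
move=> vu; rewrite /dsum (bigD1 v) //= distxx add0n -(sum_del (dist v)).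
rewrite -[#|_|]sum1_card -big_split; apply: leq_sum => x _ /=.
apply: leq_trans (dist_triangle Gc _ (undel u) _) _.
by rewrite leq_add ?dist_del //; have := vu; rewrite -(dist1 Gc) => /eqP ->.
Qed.

End DeletionDistance.

Lemma far_vertex (G : sgraph) (w : G) (A : pred G) : (exists x, A x) ->
  exists2 v, A v & forall y, A y -> dist w y <= dist w v.
Proof. by case=> x0 Ax0; case: (arg_maxnP (dist w) Ax0) => v Av le; exists v. Qed.

(** A vertex farthest from a fixed one is never a cut vertex. *)
Lemma exists_noncut (G : sgraph) : connected G -> 1 < #|G| ->
  exists v : G, connected (del v).
Proof.
move=> Gc; case/card_gt1P => w [z [_ _ wz]].
have [|v vw vfar] := @far_vertex G w (fun x => x != w); first by exists z; rewrite eq_sym.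
exists v; apply: (@connected_del_far _ Gc _ w); first by rewrite eq_sym.
by move=> y _; have [->|yw] := eqVneq y w; [rewrite distxx | apply: vfar].
Qed.

Lemma deg_gt0 (G : sgraph) (v : G) : connected G -> 1 < #|G| -> 0 < deg v.
Proof.
move=> Gc; case/card_gt1P => x [y [_ _ xy]].
have [w vw] : exists w, v != w.
  by have [->|] := eqVneq v x; [exists y | exists x].
rewrite degE; apply/card_gt0P.
have wv : w != v by rewrite eq_sym.
have [z zv _] := dist_parent Gc wv.
by exists z; rewrite inE adj_sym.
Qed.

(** * Bounds from the number of edges *)

(** In terms of W the bound is (n^3 - n)/6, the Wiener index of the path. Restoring a noncut vertex
    costs at most the n(n - 1)/2 of [dsum_le]. *)
Lemma dsum2_le (G : sgraph) : connected G -> 3 * dsum2 G + #|G| <= #|G| ^ 3.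
Proof.
have [n] := ubnP #|G|; elim: n G => // n IHn G Gn Gc.
have [G1|G2] := leqP #|G| 1.
  have -> : #|G| = 1 by have := Gc.1; lia.
  rewrite /dsum2 /dsum big1 // => x _; rewrite big1 // => y _.
  by have /card_le1_eqP/(_ x y isT isT)-> := G1; rewrite distxx.
have [v dc] := exists_noncut Gc G2.
have := IHn _ _ dc; have := dsum2_del Gc dc; have := dsum_le Gc v.
rewrite -(card_del v) => h1 h2 h3.
by have := h3 ltac:(have := card_del v; lia); nia.
Qed.

(** At least as many edges as vertices force a cycle; the first bound is W <= (n^3 - 7n + 12)/6, the
    value on a triangle with a pendant path. Both bounds share one induction: deleting a pendant
    vertex keeps the hypothesis, and its distance sum reduces to that of its neighbour. *)
Lemma dsum2_le_cyclic (G : sgraph) : connected G -> 2 * #|G| <= degsum G ->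
  3 * dsum2 G + 7 * #|G| <= #|G| ^ 3 + 12 /\
  forall u : G, 2 * dsum u + #|G| + 2 <= #|G| ^ 2.
Proof.
have [n] := ubnP #|G|; elim: n G => [|n IHn] G Gn Gc GS; first by rewrite ltn0 in Gn.
have [G1|G2] := leqP #|G| 1.
  suff : degsum G = 0 by have := Gc.1; lia.
  rewrite /degsum /deg big1 // => x _; rewrite big1 // => y _.
  by have /card_le1_eqP/(_ x y isT isT)-> := G1; rewrite adj_irr.
have IH (v : G) : deg v = 1 -> connected (del v) ->
    3 * dsum2 (del v) + 7 * #|del v| <= #|del v| ^ 3 + 12 /\
    forall u : del v, 2 * dsum u + #|del v| + 2 <= #|del v| ^ 2.
  move=> v1 dc; apply: IHn => //; first by have := card_del v; lia.
  by have := degsum_del v; have := card_del v; lia.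
have deg_lt (v : G) : deg v < #|G|.
  by rewrite -(far0 Gc v) ltnS -(far1 Gc) leq_addr.
have D (u : G) : 2 * dsum u + #|G| + 2 <= #|G| ^ 2.
  have [u1|u2] := leqP (deg u) 1; last first.
    have := @dsum_le_deg _ Gc u 2 u2; have := deg_lt u; rewrite -(card_del u).
    by case: #|del u| => [|[|m]] lt; [lia | lia | move/(_ isT); nia].
  have {}u1 : deg u = 1 by have := deg_gt0 u Gc G2; lia.
  have dc := connected_del_pendant Gc u1.
  have [z zE] := deg1P u1; have uz : adj u z by rewrite zE.
  have [|y yE] := @undelP _ u z; first by apply: contraTneq uz => ->; rewrite adj_irr.
  rewrite -yE in uz; have := dsum_pendant Gc dc uz.
  by have [_ /(_ y)] := IH u u1 dc; rewrite -(card_del u); nia.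
split=> //; have [v dc] := exists_noncut Gc G2.
have := dsum2_del Gc dc; have [v1|v2] := leqP (deg v) 1.
  have {}v1 : deg v = 1 by have := deg_gt0 v Gc G2; lia.
  by have [+ _] := IH v v1 dc; have := D v; rewrite -(card_del v); nia.
(* Deleting a vertex of degree at least 2 may destroy all cycles, but the saving in [dsum v] then
   makes up for using the path bound on the rest. *)
have := dsum2_le dc; have := @dsum_le_deg _ Gc v 2 v2; have := deg_lt v.
rewrite -(card_del v).
by case: #|del v| => [|[|m]] lt; [lia | lia | move/(_ isT); nia].
Qed.

(** * Counting edges outside a vertex set *)

Section Counting.
Variables (G : sgraph) (S : {set G}).

(** Split the adjacency matrix into blocks along [S] and its complement; the two mixed blocks have
    equal sums. *)
Lemma degsum_setC :
  degsum G + \sum_(x in S) \sum_(y in S) adj x y =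
  \sum_(x in ~: S) \sum_(y in ~: S) adj x y + 2 * \sum_(x in S) deg x.
Proof.
have SE (F : G -> nat) : \sum_x F x = \sum_(x in S) F x + \sum_(x in ~: S) F x.
  by rewrite (bigID (mem S)) /=; congr (_ + _); apply: eq_bigl => x; rewrite inE.
have SF x : deg x = \sum_(y in S) adj x y + \sum_(y in ~: S) adj x y by exact: SE.
have degs (P : {set G}) : \sum_(x in P) deg x =
    \sum_(x in P) \sum_(y in S) adj x y + \sum_(x in P) \sum_(y in ~: S) adj x y.
  by rewrite -big_split; apply: eq_bigr => x _; apply: SF.
have : \sum_(x in ~: S) \sum_(y in S) adj x y = \sum_(x in S) \sum_(y in ~: S) adj x y.
  by rewrite exchange_big; apply: eq_bigr => x _; apply: eq_bigr => y _; rewrite adj_sym.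
by have := degs S; have := degs (~: S); rewrite /degsum SE; lia.
Qed.

(** Outside [S] every vertex except [w] has an edge down the potential [F]. These edges are
    distinct, and the double sum counts each of them twice. *)
Lemma rooted_count (w : G) (F : G -> nat) : w \notin S ->
  (forall x, x \notin S -> x != w -> exists y, [/\ y \notin S, adj y x & F y < F x]) ->
  2 * #|~: S| <= \sum_(x in ~: S) \sum_(y in ~: S) adj x y + 2.
Proof.
move=> wS Fdec.
have down x : x \in ~: S -> (x != w : nat) <= \sum_(y in ~: S) (adj x y && (F y < F x)).
  rewrite inE => xS; case: eqP => //= /eqP xw.
  have [y [yS yx Fyx]] := Fdec x xS xw.
  by rewrite (bigD1 y) ?inE //= adj_sym yx Fyx.
have : \sum_(x in ~: S) (x != w) <= \sum_(x in ~: S) \sum_(y in ~: S) (adj x y && (F y < F x)).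
  exact: leq_sum.
have -> : \sum_(x in ~: S) (x != w) = #|~: S|.-1.
  rewrite (cardsD1 w) inE wS /= -sum1_card (bigD1 w) ?inE //= eqxx add0n.
  rewrite -big_mkcondr /= big_mkcond [RHS]big_mkcond /=.
  by apply: eq_bigr => x _; rewrite !inE; case: eqP; case: (x \in S).
set D := (X in _ <= X -> _) => cD.
have : D + D <= \sum_(x in ~: S) \sum_(y in ~: S) adj x y; last by lia.
rewrite {2}/D exchange_big /= /D -big_split; apply: leq_sum => x _.
rewrite -big_split; apply: leq_sum => y _ /=.
by rewrite [adj y x]adj_sym; case: (adj x y) => //=; case: ltngtP.
Qed.

(** A connected [G - S] takes up at least n - |S| - 1 edges; what remains of the edge count limits
    the degrees in [S]. *)
Lemma deg_set_le (w : G) (F : G -> nat) : w \notin S ->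
  (forall x, x \notin S -> x != w -> exists y, [/\ y \notin S, adj y x & F y < F x]) ->
  2 * #|G| + 2 * \sum_(x in S) deg x <=
  degsum G + \sum_(x in S) \sum_(y in S) adj x y + 2 * #|S| + 2.
Proof.
move=> wS /(rooted_count wS); rewrite degsum_setC -(cardsC S).
by set a := \sum_(x in ~: S) _; lia.
Qed.

End Counting.

(** * Graphs without pendant vertices *)

(* This says W <= thr(n), since dsum2 is 2W. *)
Definition wiener_small (G : sgraph) := 3 * dsum2 G + 19 * #|G| <= #|G| ^ 3 + 48.

Section NoPendant.
Variables (G : sgraph) (Gc : connected G) (GS : degsum G = 2 * #|G| + 2).
Hypotheses (G7 : 7 <= #|G|) (deg_ge2 : forall x : G, 2 <= deg x).
Implicit Types u v w x y z p q t b : G.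

(** [G - v] still has as many edges as vertices, so [dsum2_le_cyclic] applies. The condition on
    [dsum v] is exactly the gap between that bound at order n - 1 and thr(n). *)
Lemma wiener_small_del v : connected (del v) -> deg v = 2 ->
  2 * dsum v + 5 * #|G| <= #|G| ^ 2 + 10 -> wiener_small G.
Proof.
move=> dc v2 dv; have := dsum2_del Gc dc.
have [|+ _] := dsum2_le_cyclic dc.
  by have := degsum_del v; have := card_del v; lia.
by move: dv; rewrite /wiener_small -(card_del v); nia.
Qed.

Lemma far_le v j k : far v (j + k) <= far v j - k.
Proof.
by elim: k => [|k IHk]; rewrite ?addn0 ?subn0 // addnS; have := far_dec Gc v (j + k); lia.
Qed.

(* At distance |G| - 3 from v there could be only one vertex, with only one
   possible neighbour. *)
Lemma ecc_le v : deg v = 2 -> far v 2 + 2 <= far v 1 -> forall z, dist v z <= #|G| - 4.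
Proof.
move=> v2 f2 z; rewrite leqNgt; apply/negP => zfar.
have f0 := far0 Gc v; have f1 := far1 Gc v; have := far_le v 2 (#|G| - 7).
have -> : 2 + (#|G| - 7) = #|G| - 5 by lia.
move=> f5; have := deg_ge2 z; rewrite degE.
have : #|[set y | adj z y]| < far v (#|G| - 5).
  rewrite /far [X in _ < X](cardsD1 z) inE.
  have -> : #|G| - 5 < dist v z by lia.
  rewrite add1n ltnS; apply: subset_leq_card; apply/subsetP => y; rewrite !inE => zy.
  apply/andP; split; first by apply: contraTneq zy => ->; rewrite adj_irr.
  by have := dist_adj Gc v (_ : adj y z); rewrite adj_sym => /(_ zy); lia.
by lia.
Qed.

Lemma wiener_small_two_layers v : connected (del v) -> deg v = 2 ->
  far v 2 + 2 <= far v 1 -> wiener_small G.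
Proof.
move=> dc v2 f2; apply: (@wiener_small_del v) => //.
by apply: dsum_le_two_layers => //; [exact: ltnW | exact: ecc_le].
Qed.

Lemma deg2P v : deg v = 2 -> exists p q, p != q /\ forall x, adj v x = (x == p) || (x == q).
Proof.
rewrite degE => /eqP/cards2P[p [q [pq /setP E]]]; exists p, q; split=> // x.
by have := E x; rewrite !inE.
Qed.

Lemma deg_seq x (s : seq G) : uniq s -> (forall y, adj x y = (y \in s)) -> deg x = size s.
Proof.
by move=> s_uniq sE; rewrite degE -(card_uniqP s_uniq); apply: eq_card => y; rewrite inE sE.
Qed.

Lemma deg_ge_seq x (s : seq G) : uniq s -> all (adj x) s -> size s <= deg x.
Proof.
move=> s_uniq /allP sE; rewrite degE -(card_uniqP s_uniq).
by apply: subset_leq_card; apply/subsetP => y /sE; rewrite inE.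
Qed.

(** A triangle hanging at [p], with [v] and [q] as its two tips. *)
Definition triangle_end v := exists p q,
  [/\ p != q, forall x, adj v x = (x == p) || (x == q), forall x, adj q x = (x == p) || (x == v),
      deg q = 2 & deg p = 3].

(** At least two vertices at distance 2 already make [dsum v] small. Otherwise there is a single
    such vertex [t], adjacent to a neighbour [p] of [v]; the cases are whether the other neighbour
    [q] is adjacent to [p] and to [t]. *)
Lemma triangle_end_or_small v : connected (del v) -> deg v = 2 ->
  wiener_small G \/ triangle_end v.
Proof.
move=> dc v2; have f0 := far0 Gc v; have f1 := far1 Gc v.
have [f2|f2] := leqP (far v 2 + 2) (far v 1).
  by left; apply: wiener_small_two_layers f2.
have fr := far_rec v 1; have far2_gt0 : 0 < far v 2 by have := far_dec Gc v 1; lia.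
have : #|[set x | dist v x == 2]| == 1.
  by have := far_dec Gc v 1; lia.
case/cards1P => t /setP tE.
have {}tE x : (dist v x == 2) = (x == t) by have := tE x; rewrite !inE.
have [p0 [q0 [pq0 v_adj0]]] := deg2P v2.
have tv2 : dist v t = 2 by apply/eqP; rewrite tE.
have [y yt] : exists2 y, adj y t & dist v t = (dist v y).+1.
  by apply: dist_parent; rewrite // -(dist_gt0 Gc) tv2.
rewrite tv2 => -[/esym/eqP]; rewrite dist1 // v_adj0 => vy.
have [p [q [pq pt v_adj]]] : exists p q, [/\ p != q, adj p t & forall x, adj v x = (x == p) || (x == q)].
  case/orP: vy => /eqP yE; subst y; first by exists p0, q0.
  by exists q0, p0; split; rewrite // 1?eq_sym // => x; rewrite v_adj0 orbC.
move: v_adj {p0 q0 pq0 v_adj0 y yt vy} => v_adj.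
have vp : adj v p by rewrite v_adj eqxx.
have vq : adj v q by rewrite v_adj eqxx orbT.
have d1 x : dist v x = 1 <-> x = p \/ x = q.
  split=> [/eqP|xpq]; first by rewrite dist1 // v_adj => /orP[]/eqP; [left|right].
  by apply/eqP; rewrite dist1 // v_adj; case: xpq => ->; rewrite eqxx ?orbT.
have vp1 : dist v p = 1 by apply/d1; left.
have vq1 : dist v q = 1 by apply/d1; right.
have near x y : dist v x = 1 -> adj x y -> [\/ y = v, y = p, y = q | y = t].
  move=> vx /(dist_adj Gc v); rewrite vx; case E: (dist v y) => [|[|[|d]]] // _.
  - by move/eqP: E; rewrite dist_eq0 // => /eqP; constructor 1.
  - by case/d1: E; [constructor 2 | constructor 3].
  - by move/eqP: E; rewrite tE => /eqP; constructor 4.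
have neqs : [/\ v != p, v != q, v != t, p != t & q != t].
  have nd x y : dist v x <> dist v y -> x != y by move=> h; apply/eqP => E; rewrite E in h.
  by split; apply: nd; rewrite ?tv2 ?vp1 ?vq1 ?distxx.
case: neqs => vp_ vq_ vt_ pt_ qt_.
have [qp|qp] := boolP (adj q p); have [qt|qt] := boolP (adj q t).
- (* K4 minus an edge at v leaves no room for a second cycle. *)
  have [|b _ bfar] := @far_vertex G v predT; first by exists v.
  have b3 : 2 < dist v b.
    case/card_gt0P: far2_gt0 => x; rewrite inE => h; exact: leq_trans h (bfar x isT).
  have nb x : dist v x <= 2 -> x != b by move=> h; apply/eqP => E; move: b3; rewrite -E ltnNge h.
  have bv : v != b by apply: nb; rewrite distxx.
  have bp : p != b by apply: nb; rewrite vp1.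
  have bt : t != b by apply: nb; rewrite tv2.
  (* The extra 2 lifts [q] above the root [t], since [q] must now descend to [t] instead of the
     deleted [v]. The degrees of [v], [p], [b] are at least 2, 3, 2 with one edge among them, which
     would give [G] at least n + 2 edges. *)
  have := @deg_set_le G (v |: [set p; b]) t (fun x => dist v x + 2 * (x == q)).
  rewrite !inE ![t == _]eq_sym (negPf vt_) (negPf pt_) eq_sym (negPf bt) => /(_ isT).
  have -> : #|(v |: [set p; b])| = 3.
    by rewrite cardsU1 cards2 !inE (negPf vp_) (negPf bv) bp.
  have nvb : adj v b = false by apply/negP; rewrite -(dist1 Gc) => /eqP E; rewrite E in b3.
  have npb : adj p b = false by apply/negP => /(dist_adj Gc v); rewrite vp1 leqNgt b3.
  have v_pb : v \notin [set p; b] by rewrite !inE negb_or vp_.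
  have p_b : p \notin [set b] by rewrite inE.
  rewrite !big_setU1 //= !big_set1 !big_setU1 //= !big_set1.
  rewrite !adj_irr vp nvb npb [adj p v]adj_sym vp ![adj b _]adj_sym nvb npb.
  have := @deg_ge_seq p [:: v; q; t]; rewrite /= !inE (negPf vq_) (negPf vt_) qt_ => /(_ isT).
  rewrite ![adj p _]adj_sym vp qp [adj t p]adj_sym pt => /(_ isT) dp.
  have := deg_ge2 b; rewrite GS v2 => db.
  move=> H; lapply H; [by move=> Q; exfalso; move: #|G| Q db dp; clear; lia | move=> {H} x].
  rewrite !inE !negb_or => /and3P[xv xp xb] xt.
  have [xq|xq] := eqVneq x q.
    have [tv_ tp_ tq_] : [/\ t != v, t != p & t != q] by rewrite ![t == _]eq_sym.
    exists t; rewrite !inE (negPf tv_) (negPf tp_) (negPf bt) (negPf tq_) xq.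
    by rewrite adj_sym qt vq1 tv2.
  have [|y yx dx] := @dist_parent _ Gc v x; first by rewrite eq_sym.
  have x2 : 2 < dist v x.
    rewrite ltn_neqAle eq_sym tE xt /= ltn_neqAle eq_sym dist_gt0 // [v == x]eq_sym xv andbT.
    apply/eqP => dE; have [E|E] := (d1 x).1 dE; [by rewrite E eqxx in xp | by rewrite E eqxx in xq].
  exists y; rewrite yx dx; split=> //; last first.
    have yq : y != q by apply/eqP => E; rewrite dx E vq1 in x2.
    by rewrite (negPf yq) ltn_add2r.
  rewrite !inE !negb_or; apply/and3P; split; apply/eqP => E.
  - by rewrite dx E distxx in x2.
  - by rewrite dx E vp1 in x2.
  - by have := bfar x isT; rewrite dx E ltnn.
(* Here [q] sees only [p] and [v], and the neighbours of [p] are [v], [q], [t]: a triangle hanging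
   at [p]. *)
- right; exists p, q.
  have q_adj x : adj q x = (x == p) || (x == v).
    apply/idP/orP => [qx|[]/eqP->]; rewrite ?qp 1?adj_sym //.
    case: (near q x vq1 qx) => E; subst x; [by right|by left| |].
      by rewrite adj_irr in qx.
    by rewrite (negPf qt) in qx.
  split=> //.
    by apply: (@deg_seq q [:: p; v]) => [|x]; rewrite /= ?inE ?q_adj // eq_sym vp_.
  apply: (@deg_seq p [:: v; q; t]); first by rewrite /= !inE negb_or vq_ vt_ qt_.
  move=> x; rewrite !inE; apply/idP/or3P => [px|[]/eqP->]; rewrite // 1?adj_sym //.
  case: (near p x vp1 px) => E; subst x; [by constructor 1| |by constructor 2|by constructor 3].
  by rewrite adj_irr in px.
(* Now [v p t q] is a 4-cycle. Then [p] has degree 2 as well, and both [q] and a vertex [s] at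
   distance 3 from [v] are at distance 2 from [p], so [p] is deleted instead of [v]. *)
- left.
  have p_adj x : adj p x = (x == v) || (x == t).
    apply/idP/orP => [px|[]/eqP->]; rewrite // 1?adj_sym //.
    case: (near p x vp1 px) => E; subst x; [by left| | |by right].
      by rewrite adj_irr in px.
    by rewrite adj_sym (negPf qp) in px.
  have [s s3] : exists s, dist v s = 3.
    by case/card_gt0P: far2_gt0 => x; rewrite inE => h; apply: (dist_ball Gc h).
  have ts : adj t s.
    have [|y ys] := @dist_parent _ Gc v s; first by rewrite -dist_gt0 // s3.
    by rewrite s3 => -[/esym/eqP]; rewrite tE => /eqP <-.
  have p2 : deg p = 2.
    by apply: (@deg_seq p [:: v; t]) => [|x]; rewrite /= ?inE ?vt_ ?p_adj ?inE.
  apply: (@wiener_small_two_layers p) => //.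
    apply: (@connected_del _ _ t (dist t)); first by rewrite eq_sym.
    move=> x xp xt; have [|y yx dx] := @dist_parent _ Gc t x; first by rewrite eq_sym.
    have [yp|yp] := eqVneq y p; last by exists y; rewrite yx dx; split.
    have {yp yx dx} xv : x = v.
      by move: yx; rewrite yp p_adj (negPf xt) orbF => /eqP.
    exists q; rewrite xv adj_sym vq eq_sym pq dist_sym // [dist t v]dist_sym // tv2; split=> //.
    by have /eqP -> : dist q t == 1 by rewrite dist1.
  have qs : q != s by apply/eqP => E; rewrite -E vq1 in s3.
  rewrite (far_rec p 1) addnC leq_add2r.
  apply: (@leq_trans #|[set q; s]|); first by rewrite cards2 qs.
  apply: subset_leq_card.
  apply/subsetP => x; rewrite !inE => xqs.
  have px : p != x by apply/eqP => E; case/orP: xqs => /eqP E'; subst; [rewrite eqxx in pq | rewrite s3 in vp1].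
  rewrite eqn_leq; apply/andP; split; last first.
    rewrite ltn_neqAle eq_sym dist_gt0 // px andbT dist1 // p_adj negb_or.
    by case/orP: xqs => /eqP ->; rewrite ?[q == v]eq_sym ?vq_ ?qt_ //;
      apply/andP; split; apply/eqP => E; rewrite E ?distxx ?tv2 in s3.
  case/orP: xqs => /eqP ->.
    by have := dist_triangle Gc p v q; rewrite vq1 [dist p v]dist_sym // vp1.
  have /eqP pt1 : dist p t == 1 by rewrite dist1.
  have /eqP ts1 : dist t s == 1 by rewrite dist1.
  by have := dist_triangle Gc p t s; rewrite pt1 ts1.
(* With neither edge present, [v] would be the only neighbour of [q]. *)
- have : deg q <= 1; last by rewrite leqNgt deg_ge2.
  rewrite degE -(cards1 v); apply: subset_leq_card; apply/subsetP => x; rewrite !inE => qx.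
  have [] := near q x vq1 qx => E; rewrite E ?eqxx //; rewrite E in qx.
  + by rewrite qx in qp.
  + by rewrite adj_irr in qx.
  + by rewrite qx in qt.
Qed.

(** Summing D(u) <= n^2/4 over all [u] gives 8W <= n^3, which is at most 8 thr(n) from n = 7 on,
    barely so at 7: 343 against 344. *)
Lemma wiener_small_no_cut :
  (forall u k, far u k.+1 != 0 -> 2 <= #|[set x | dist u x == k.+1]|) -> wiener_small G.
Proof.
move=> dbl; have : 4 * dsum2 G <= #|G| * #|G| ^ 2.
  rewrite /dsum2 big_distrr -sum_nat_const; apply: leq_sum => u _ /=.
  exact: dsum_le_double (dbl u).
rewrite /wiener_small; have [m ->] : exists m, #|G| = m + 7 by exists (#|G| - 7); rewrite subnK.
by nia.
Qed.

(** [w] is alone in its layer, so it separates the ball of radius [k] around [u] from everything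
    beyond. The ends [v] and [b] are farthest from [w] on the two sides; neither blocks a shortest
    path from [w], so both can be removed at once, and [deg_set_le] leaves them total degree at most
    4. *)
Lemma cut_ends u k w z : (forall x, (dist u x == k.+1) = (x == w)) -> k.+1 < dist u z ->
  exists v b, [/\ v != b, adj v b = false, deg v = 2 /\ deg b = 2, connected (del v) & connected (del b)].
Proof.
move=> wE kz; have uw : dist u w = k.+1 by apply/eqP; rewrite wE.
have [|v] := @far_vertex G w (fun x => dist u x <= k); first by exists u; rewrite distxx.
move=> vk vfar; have [|b] := @far_vertex G w (fun x => k.+1 < dist u x); first by exists z.
move=> bk bfar.
have low x y : adj x y -> dist u y <= k -> x != w -> dist u x <= k.
  move=> xy yk; rewrite -wE => xk; rewrite adj_sym in xy.
  by have := dist_adj Gc u xy; lia.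
have high x y : adj x y -> k.+1 < dist u y -> x != w -> k.+1 < dist u x.
  by move=> /(dist_adj Gc u) + yk; rewrite -wE; lia.
have wv : w != v by apply/eqP => E; rewrite -E uw in vk; lia.
have wb : w != b by apply/eqP => E; rewrite -E uw in bk; lia.
have vb : v != b by apply/eqP => E; rewrite -E in bk; lia.
have nvb : adj v b = false by apply/negP => /(dist_adj Gc u); lia.
have vmax y : adj v y -> dist w y <= dist w v.
  have [->|yw] := eqVneq y w; first by rewrite distxx.
  by rewrite adj_sym => yv; apply: vfar; apply: low yv vk yw.
have bmax y : adj b y -> dist w y <= dist w b.
  have [->|yw] := eqVneq y w; first by rewrite distxx.
  by rewrite adj_sym => yb; apply: bfar; apply: high yb bk yw.
have vc := connected_del_far Gc wv vmax; have bc := connected_del_far Gc wb bmax.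
exists v, b; split=> //.
have := @deg_set_le G [set v; b] w (dist w); rewrite !inE (negPf wv) (negPf wb) => /(_ isT).
rewrite cards2 vb !big_setU1 ?big_set1 ?inE // !big_setU1 ?big_set1 ?inE //= !adj_irr.
rewrite nvb [adj b v]adj_sym nvb GS; have := deg_ge2 v; have := deg_ge2 b => b2 v2.
move=> H; lapply H; [by move=> Q; move: #|G| Q b2 v2; clear; lia | move=> {H} x].
rewrite !inE negb_or => /andP[xv xb] xw.
have [|y yx dx] := @dist_parent _ Gc w x; first by rewrite eq_sym.
exists y; rewrite yx dx; split=> //; rewrite !inE negb_or; apply/andP.
by split; apply/eqP => E; rewrite E in yx dx; [have := vmax x yx | have := bmax x yx];
  rewrite dx ltnn.
Qed.

Lemma triangle_ends_or_small : wiener_small G \/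
  exists v b, [/\ v != b, adj v b = false, triangle_end v & triangle_end b].
Proof.
(* Tails [far u k] with [k] at least [#|G|] are zero, so the search for a layer with a single vertex
   is finite. *)
have [dbl|] := boolP [forall u : G, [forall k : 'I_#|G|,
    (far u k.+1 != 0) ==> (2 <= #|[set x | dist u x == k.+1]|)]].
  left; apply: wiener_small_no_cut => u k fk.
  have kG : k < #|G|.
    rewrite ltnNge; apply: contra fk => Gk; apply/eqP/far_eq0 => x.
    by apply: leqW; apply: leq_trans (ltnW (dist_lt_card Gc u x)) Gk.
  by have /forallP/(_ u)/forallP/(_ (Ordinal kG))/implyP/(_ fk) := dbl.
case/forallPn => u /forallPn[k]; rewrite negb_imply -ltnNge => /andP[fk lk].
have [z] : exists z, z \in [set x | k.+1 < dist u x] by apply/card_gt0P; rewrite lt0n.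
rewrite inE => kz.
have [|w0 /eqP w0k] := @dist_ball _ Gc u z k.+1; first by lia.
have : #|[set x | dist u x == k.+1]| == 1.
  rewrite eqn_leq -ltnS lk; apply/card_gt0P; exists w0; by rewrite inE.
case/cards1P => w /setP wE.
have [|v [b [vb nvb [v2 b2] vc bc]]] := @cut_ends u k w z _ kz.
  by move=> x; have := wE x; rewrite !inE.
have [|tv] := triangle_end_or_small vc v2; first by left.
have [|tb] := triangle_end_or_small bc b2; first by left.
by right; exists v, b.
Qed.

End NoPendant.

(** * Labelled graphs and the extremal families *)

(** Labels are plain naturals, so that one relation [e] can serve a whole family as the order
    grows. *)
Definition labelled (G : sgraph) (n : nat) (e : rel nat) (f : G -> nat) : Prop :=
  [/\ injective f, forall x, f x < n, #|G| = n & forall x y, adj x y = e (f x) (f y)].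

Definition shaped (G : sgraph) n e := exists f, @labelled G n e f.

(** The conditions of [dist_certificate] for every source, stated on labels so that a closed formula
    [D] can be verified by arithmetic. *)
Definition metric_on (n : nat) (e : rel nat) (D : nat -> nat -> nat) :=
  forall i, i < n ->
  [/\ D i i = 0, forall j k, j < n -> k < n -> e j k -> D i k <= (D i j).+1 &
      forall j, j < n -> j != i -> exists k, [/\ k < n, e k j & D i k < D i j]].

Section Labelled.
Variables (G : sgraph) (n : nat) (e : rel nat) (f : G -> nat).
Hypothesis fP : labelled n e f.

Lemma labelled_bij : exists2 g : G -> 'I_n, bijective g & forall x, val (g x) = f x.
Proof.
case: fP => f_inj fn Gn _.
pose g x : 'I_n := Ordinal (fn x); exists g => //.
by apply: inj_card_bij; rewrite ?card_ord ?Gn // => x y /(congr1 val)/= /f_inj.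
Qed.

Lemma labelled_surj i : i < n -> exists x, f x = i.
Proof.
have [g [h _ gh] gE] := labelled_bij => ilt.
by exists (h (Ordinal ilt)); rewrite -gE gh.
Qed.

Lemma labelled_sum F : \sum_(x : G) F (f x) = \sum_(i < n) F i.
Proof.
have [g g_bij gE] := labelled_bij.
rewrite (reindex g) /=; last by case: g_bij => h gh hg; exists h => x _.
by apply: eq_bigr => x _; rewrite -gE.
Qed.

Lemma labelled_deg x : deg x = \sum_(i < n) e (f x) i.
Proof.
case: fP => _ _ _ fe; rewrite -(labelled_sum (fun i => e (f x) i : nat)).
by apply: eq_bigr => y _; rewrite fe.
Qed.

Lemma labelled_degsum : degsum G = \sum_(i < n) \sum_(j < n) e i j.
Proof.
rewrite -(labelled_sum (fun i => \sum_(j < n) e i j)).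
by apply: eq_bigr => x _; apply: labelled_deg.
Qed.

Lemma labelled_deg_ge (s : seq nat) x : uniq s -> all (fun i => (i < n) && e (f x) i) s ->
  size s <= deg x.
Proof.
case: fP => f_inj fn _ fe s_uniq /allP sP; rewrite degE.
have -> : #|[set y | adj x y]| = size [seq f y | y <- enum [set y | adj x y]].
  by rewrite size_map cardE.
apply: uniq_leq_size => // i /sP/andP[ilt ei].
have [y yi] := labelled_surj ilt; apply/mapP; exists y => //.
by rewrite mem_enum inE fe yi.
Qed.

Lemma labelled_shift e' (h : nat -> nat) :
  (forall i, i < n -> h i < n) -> (forall i j, i < n -> j < n -> h i = h j -> i = j) ->
  (forall i j, i < n -> j < n -> e' (h i) (h j) = e i j) -> labelled n e' (h \o f).
Proof.
case: fP => f_inj fn Gn fe hn h_inj he; split=> // [x y|x|x y] /=; last by rewrite he.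
  by move/h_inj => /(_ (fn _) (fn _)) /f_inj.
exact: hn.
Qed.

Lemma labelled_ext e' : (forall i j, i < n -> j < n -> e' i j = e i j) -> labelled n e' f.
Proof. by case: fP => f_inj fn Gn fe ee; split=> // x y; rewrite fe ee. Qed.

Lemma labelled_iso es : (forall i j, i < n -> j < n ->
    e i j = (i != j) && (((i, j) \in es) || ((j, i) \in es))) ->
  iso G (of_edges n es).
Proof.
case: fP => _ fn _ fe eE; have [g g_bij gE] := labelled_bij.
exists g; split=> // x y; rewrite fe -!gE eE //= /of_edges_rel -val_eqE.
Qed.

Variable D : nat -> nat -> nat.
Hypothesis De : metric_on n e D.

Lemma labelled_connect x y : connect (@adj G) x y /\ dist x y = D (f x) (f y).
Proof.
case: fP => f_inj fn Gn fe; have [Dxx Dlip Ddec] := De (fn x).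
apply: (@dist_certificate G x (fun y => D (f x) (f y))) => // [a b|z zx].
  by rewrite fe; apply: Dlip.
have [|k [kn ek Dk]] := Ddec (f z) (fn z); first by rewrite (inj_eq f_inj).
by have [a fa] := labelled_surj kn; exists a; rewrite ?fe fa.
Qed.

Lemma labelled_dist x y : dist x y = D (f x) (f y).
Proof. by case: (labelled_connect x y). Qed.

Lemma labelled_connected : 0 < n -> connected G.
Proof.
by case: fP => _ _ Gn _ n0; split=> [|x y]; [rewrite Gn | case: (labelled_connect x y)].
Qed.

Lemma labelled_dsum x : dsum x = \sum_(i < n) D (f x) i.
Proof.
by rewrite -(labelled_sum (D (f x))); apply: eq_bigr => y _; rewrite labelled_dist.
Qed.

Lemma labelled_dsum2 : dsum2 G = \sum_(i < n) \sum_(j < n) D i j.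
Proof.
rewrite -(labelled_sum (fun i => \sum_(j < n) D i j)).
by apply: eq_bigr => x _; apply: labelled_dsum.
Qed.

End Labelled.

Lemma iso_labelled (G : sgraph) n es e : iso G (of_edges n es) ->
  (forall i j, i < n -> j < n ->
    e i j = (i != j) && (((i, j) \in es) || ((j, i) \in es))) -> shaped G n e.
Proof.
case=> g [g_bij gE] eE; exists (fun x => nat_of_ord (g x)); split=> [x y|x||x y].
- by move/ord_inj/(bij_inj g_bij).
- exact: ltn_ord.
- by rewrite (bij_eq_card g_bij) card_ord.
- by rewrite -gE eE.
Qed.

Lemma of_edges_shaped n es e : (forall i j, i < n -> j < n ->
    e i j = (i != j) && (((i, j) \in es) || ((j, i) \in es))) ->
  shaped (of_edges n es) n e.
Proof. by apply: iso_labelled; exists id; split=> //; exists id. Qed.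

Lemma labelled_extend (G : sgraph) (v : G) m (e e' : rel nat) (f : del v -> nat) :
  labelled m e f -> symmetric e' -> e' m m = false ->
  (forall i j, i < m -> j < m -> e' i j = e i j) ->
  (forall x : del v, adj v (undel x) = e' m (f x)) ->
  exists f' : G -> nat, [/\ labelled m.+1 e' f', f' v = m & forall x, f' (undel x) = f x].
Proof.
case=> f_inj fm Gm fe e'_sym e'm e'e ve.
pose f' (x : G) := oapp f m (insub x : option (del v)).
have f'v : f' v = m by rewrite /f' insubF // eqxx.
have f'E x : f' (undel x) = f x by rewrite /f' [insub _]valK.
have caseG (x : G) : x = v \/ exists y : del v, x = undel y.
  have [->|xv] := eqVneq x v; first by left.
  by right; have [y yx] := undelP xv; exists y.
exists f'; split=> //; split=> [x y|x||x y].
- case: (caseG x) => [->|[x' ->]]; case: (caseG y) => [->|[y' ->]] //; rewrite ?f'v ?f'E.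
  + by move=> E; have := fm y'; rewrite -E ltnn.
  + by move=> E; have := fm x'; rewrite E ltnn.
  + by move/f_inj ->.
- by case: (caseG x) => [->|[x' ->]]; rewrite ?f'v ?f'E // ltnS ltnW.
- by rewrite -(card_del v) Gm.
- case: (caseG x) => [->|[x' ->]]; case: (caseG y) => [->|[y' ->]] //; rewrite ?f'v ?f'E.
  + by rewrite adj_irr e'm.
  + exact: ve.
  + by rewrite adj_sym ve e'_sym.
  + by rewrite e'e // -fe.
Qed.

Lemma labelled_pendant (G : sgraph) (v : G) m (e e' : rel nat) (f : del v -> nat) (u : del v) :
  labelled m e f -> (forall x, adj v x = (x == undel u)) -> symmetric e' -> e' m m = false ->
  (forall i j, i < m -> j < m -> e' i j = e i j) ->
  (forall i, i < m -> e' m i = (i == f u)) ->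
  exists f' : G -> nat, [/\ labelled m.+1 e' f', f' v = m & forall x, f' (undel x) = f x].
Proof.
move=> fP vu e'_sym e'm e'e e'u; apply: (labelled_extend fP) => // x.
case: fP => f_inj fm _ _; rewrite vu e'u // (inj_eq f_inj).
exact: (inj_eq (@undel_inj G v)).
Qed.

Definition consecutive (i j : nat) := (j == i.+1) || (i == j.+1).
Definition chord (a b i j : nat) := ((i == a) && (j == b)) || ((i == b) && (j == a)).

(** A Hamiltonian path plus two chords. In this numbering, attaching a vertex at the last one only
    adds the next label. *)
Definition eB s : rel nat := fun i j =>
  [|| consecutive i j, chord s s.+2 i j | chord s.+1 s.+3 i j].
Definition eB1 : rel nat := fun i j =>
  [|| consecutive i j && ~~ chord 0 1 i j, chord 0 2 i j, chord 0 3 i j | chord 1 3 i j].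
Definition eBpq n : rel nat := fun i j =>
  [|| consecutive i j, chord 0 2 i j | chord (n - 3) (n - 1) i j].
(** The lollipop: a triangle on 0, 1, 2 with a path attached at 2. *)
Definition elolli : rel nat := fun i j => consecutive i j || chord 0 2 i j.

Lemma mem_path_edges a k i j :
  ((i, j) \in path_edges (iota a k)) = [&& j == i.+1, a <= i & j < a + k].
Proof.
case: k => [|k]; first by rewrite in_nil; lia.
rewrite /path_edges /=; elim: k a => [|k IHk] a; first by rewrite in_nil; lia.
by rewrite [iota _ _]/= /= inE xpair_eqE IHk; lia.
Qed.

Lemma eB_edges n s i j : s + 4 <= n -> i < n -> j < n ->
  let es := K4minus_edges s s.+1 s.+2 s.+3 ++ path_edges (iota 0 s.+1)
              ++ path_edges (iota s.+3 (n - s - 3)) in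
  eB s i j = (i != j) && (((i, j) \in es) || ((j, i) \in es)).
Proof.
move=> ns ilt jlt es.
have esE x y : ((x, y) \in es) = (y == x.+1) && (y < n) || (y == x.+2) && ((x == s) || (x == s.+1)).
  rewrite /es !mem_cat !mem_path_edges !inE !xpair_eqE.
  by case: (ltngtP x s) => xs; case: (ltngtP y x.+1) => yx; lia.
by rewrite !esE /eB /consecutive /chord; lia.
Qed.

Lemma eB1_edges n i j : 4 <= n -> i < n -> j < n ->
  let es := K4minus_edges 0 2 3 1 ++ path_edges (iota 3 (n - 3)) in
  eB1 i j = (i != j) && (((i, j) \in es) || ((j, i) \in es)).
Proof.
move=> n4 ilt jlt es; rewrite /es !mem_cat !mem_path_edges !inE !xpair_eqE (subnKC (ltnW n4)).
rewrite /eB1 /consecutive /chord.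
by move: i j ilt jlt {es} => [|[|[|[|i]]]] [|[|[|[|j]]]] ilt jlt //=; lia.
Qed.

Lemma eBpq_edges n i j : 5 <= n -> i < n -> j < n ->
  let es := cycle_edges (iota 0 3) ++ path_edges (iota 3.-1 (n + 2 - 3 - 3))
              ++ cycle_edges (iota (n - 3) 3) in
  eBpq n i j = (i != j) && (((i, j) \in es) || ((j, i) \in es)).
Proof.
move=> n5 ilt jlt es.
have esE x y : ((x, y) \in es) =
    [|| (y == x.+1) && (y < n), (x == 2) && (y == 0) | (x == n - 1) && (y == n - 3)].
  rewrite /es !mem_cat !mem_path_edges /cycle_edges /= !inE !xpair_eqE.
  have [m mE] : exists m, n = m + 5 by exists (n - 5); rewrite subnK.
  by rewrite {n5 ilt jlt es}mE; case: (ltngtP y x.+1) => yx; lia.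
by rewrite !esE /eBpq /consecutive /chord; lia.
Qed.

Lemma consecutiveC i j : consecutive i j = consecutive j i.
Proof. exact: orbC. Qed.
Lemma chordC a b i j : chord a b i j = chord a b j i.
Proof. by rewrite /chord orbC ![(i == _) && _]andbC. Qed.

Lemma eB_sym s : symmetric (eB s).
Proof. by move=> i j; rewrite /eB consecutiveC !(chordC _ _ i). Qed.
Lemma eB1_sym : symmetric eB1.
Proof. by move=> i j; rewrite /eB1 consecutiveC !(chordC _ _ i). Qed.
Lemma eBpq_sym n : symmetric (eBpq n).
Proof. by move=> i j; rewrite /eBpq consecutiveC !(chordC _ _ i). Qed.
Lemma elolli_sym : symmetric elolli.
Proof. by move=> i j; rewrite /elolli consecutiveC !(chordC _ _ i). Qed.

(** * Distances in the extremal families *)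

Definition gap (a b : nat) := (a - b) + (b - a).
(** Vertices are placed on a line by [x]; the maximum handles adjacent vertices that share a
    position. *)
Definition coord_dist (x : nat -> nat) i j := maxn (i != j) (gap (x i) (x j)).

(** Adjacency means coordinates at most 1 apart and no coordinate is skipped, so a shortest path
    moves one unit at a time towards its goal. *)
Lemma metric_coord n (e : rel nat) x :
  (forall i j, i < n -> j < n -> e i j = (i != j) && (gap (x i) (x j) <= 1)) ->
  (forall i j a, i < n -> j < n -> x i <= a <= x j -> exists2 k, k < n & x k = a) ->
  metric_on n e (coord_dist x).
Proof.
move=> eE x_itv i ilt; split=> [|j k jlt klt|j jlt ji].
- by rewrite /coord_dist /gap eqxx; lia.
- by rewrite eE // /coord_dist /gap; lia.
- have [le1|gt1] := leqP (gap (x i) (x j)) 1.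
    exists i; rewrite ilt eE // [i == j]eq_sym ji le1; split=> //.
    by rewrite /coord_dist /gap eqxx [i == j]eq_sym ji; lia.
  have [lt|le] := ltnP (x i) (x j).
    have [|k klt xk] := x_itv i j (x j).-1 ilt jlt; first by lia.
    exists k; rewrite klt eE // /coord_dist; split=> //; last by move: gt1 xk; rewrite /gap; lia.
    by rewrite (_ : k != j) /gap ?xk; [lia|apply/eqP => E; rewrite E in xk; lia].
  have [|k klt xk] := x_itv j i (x j).+1 jlt ilt; first by move: gt1; rewrite /gap; lia.
  exists k; rewrite klt eE // /coord_dist; split=> //; last by move: gt1 xk; rewrite /gap; lia.
  by rewrite (_ : k != j) /gap ?xk; [lia|apply/eqP => E; rewrite E in xk; lia].
Qed.

(** Twins share a coordinate: the degree-3 vertices s + 1 and s + 2 here, the two tips of a triangle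
    in [xBpq] and [xlolli]. *)
Definition xB s i := i - (s.+2 <= i).
Definition xBpq n i := minn (maxn 1 i) (n - 2).
Definition xlolli i := maxn 1 i.
Definition DB s := coord_dist (xB s).
Definition DBpq n := coord_dist (xBpq n).
Definition Dlolli := coord_dist xlolli.
(** The vertices 0, 1, 2 are all neighbours of 3, but 0 and 1 are not adjacent, so no [coord_dist]
    fits; seen from the path, all three sit at position 2. *)
Definition DB1 i j :=
  if i == j then 0 else
  if (i < 3) && (j < 3) then (if i + j == 1 then 2 else 1) else gap (maxn 2 i) (maxn 2 j).

Lemma metric_B s n : s + 4 <= n -> metric_on n (eB s) (DB s).
Proof.
move=> ns; apply: metric_coord => [i j ilt jlt|i j a ilt jlt /andP[ia aj]].
  by rewrite /eB /consecutive /chord /gap /xB; case: (ltngtP i j); lia.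
by exists (a + (s.+2 <= a)); move: ia aj; rewrite /xB; lia.
Qed.

Lemma metric_Bpq n : 5 <= n -> metric_on n (eBpq n) (DBpq n).
Proof.
move=> n5; apply: metric_coord => [|i j a ilt jlt /andP[ia aj]]; last first.
  by exists a; move: ia aj; rewrite /xBpq; lia.
have ordered i j : i < j -> j < n ->
    eBpq n i j = (i != j) && (gap (xBpq n i) (xBpq n j) <= 1).
  move=> ij jn; rewrite /eBpq.
  have -> : consecutive i j = (j == i.+1) by rewrite /consecutive; lia.
  have -> : chord 0 2 i j = (i == 0) && (j == 2) by rewrite /chord; lia.
  have -> : chord (n - 3) (n - 1) i j = (i == n - 3) && (j == n - 1) by rewrite /chord; lia.
  by rewrite /gap /xBpq; lia.
move=> i j ilt jlt; case: (ltngtP i j) => ij; first by rewrite ordered // neq_ltn ij.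
  by rewrite eBpq_sym ordered // neq_ltn ij /gap addnC.
by rewrite ij /eBpq /consecutive /chord; lia.
Qed.

Lemma metric_B1 n : 4 <= n -> metric_on n eB1 DB1.
Proof.
move=> n4 i ilt; split=> [|j k jlt klt|j jlt ji]; first by rewrite /DB1 eqxx.
  rewrite /eB1 /consecutive /chord /DB1 /gap.
  by move: i j k ilt jlt klt => [|[|[|i]]] [|[|[|j]]] [|[|[|k]]] ilt jlt klt //=;
    repeat case: eqP => /= ?; lia.
have [lt|ge] := boolP ((i < 3) && (j < 3)).
  exists (if i + j == 1 then 2 else i).
  by rewrite /eB1 /consecutive /chord /DB1 /gap; move: i j lt ilt jlt ji => [|[|[|i]]] [|[|[|j]]] lt ilt jlt ji; split=> /=; lia.
exists (if i < j then (if (j == 3) then i else j.-1) else (if j < 3 then 3 else j.+1)).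
rewrite /eB1 /consecutive /chord /DB1 /gap.
by case: (ltngtP i j) => ij; case: (ltngtP j 3) => j3; split=> /=; repeat case: ifP => /= ?; lia.
Qed.

(** * Closed forms for distance sums along a growing path *)

Section Sums.
Variables (D : nat -> nat -> nat) (n0 c : nat).
Hypotheses (Dsym : forall i j, D i j = D j i) (Dxx : forall i, D i i = 0).
Hypothesis D_step : forall n i, n0 <= n -> i < n -> D i n.+1 = (D i n).+1.
Hypothesis D_next : forall n, n0 <= n -> D n n.+1 = 1.
Hypothesis col0 : 2 * \sum_(i < n0) D i n0 + c = n0 ^ 2 + n0.

(** Vertex n + 1 hangs behind n, so every entry of the column grows by one and a final 1 is added.
    The deficit [c] against n^2 + n is fixed by the initial part. *)
Lemma column_sum n : n0 <= n -> 2 * \sum_(i < n) D i n + c = n ^ 2 + n.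
Proof.
elim: n => [|n IHn]; first by rewrite leqn0 => /eqP n00; move: col0; rewrite n00.
rewrite leq_eqVlt => /predU1P[<- //|le]; rewrite big_ord_recr /= D_next //.
rewrite (eq_bigr (fun i : 'I_n => D i n + 1)) => [|i _]; last by rewrite D_step ?addn1.
by rewrite big_split /= sum1_card card_ord; move: (IHn le); move: (\sum_(_ < _) _) => s; nia.
Qed.

Lemma total_rec n :
  \sum_(i < n.+1) \sum_(j < n.+1) D i j = \sum_(i < n) \sum_(j < n) D i j + 2 * \sum_(i < n) D i n.
Proof.
rewrite big_ord_recr /= [X in _ + X]big_ord_recr /= Dxx addn0.
rewrite (eq_bigr (fun i : 'I_n => \sum_(j < n) D i j + D i n)) => [|i _]; last first.
  by rewrite big_ord_recr.
rewrite big_split /= -addnA mul2n -addnn; congr (_ + (_ + _)).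
by apply: eq_bigr => i _; rewrite Dsym.
Qed.

Variable b : nat.
Hypothesis tot0 : 3 * (\sum_(i < n0) \sum_(j < n0) D i j) + (3 * c + 1) * n0 = n0 ^ 3 + b.

(** A new vertex contributes its column twice, and 3 (n^2 + n - c) = (n + 1)^3 - n^3 - (3 c + 1),
    whence the linear coefficient. *)
Lemma total_sum n : n0 <= n ->
  3 * (\sum_(i < n) \sum_(j < n) D i j) + (3 * c + 1) * n = n ^ 3 + b.
Proof.
elim: n => [|n IHn]; first by rewrite leqn0 => /eqP n00; move: tot0; rewrite n00.
rewrite leq_eqVlt => /predU1P[<- //|le]; rewrite total_rec.
by have := IHn le; have := column_sum le; nia.
Qed.
End Sums.

Lemma coord_dist_sym x i j : coord_dist x i j = coord_dist x j i.
Proof. by rewrite /coord_dist /gap eq_sym addnC. Qed.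
Lemma coord_distxx x i : coord_dist x i i = 0.
Proof. by rewrite /coord_dist eqxx /gap; lia. Qed.

Lemma DB1_sym i j : DB1 i j = DB1 j i.
Proof. by rewrite /DB1 /gap eq_sym andbC [i + j]addnC [_ - maxn 2 j + _]addnC. Qed.
Lemma DB1xx i : DB1 i i = 0.
Proof. by rewrite /DB1 eqxx. Qed.

Lemma total_Bn0 n : 4 <= n -> 3 * (\sum_(i < n) \sum_(j < n) DB 0 i j) + 13 * n = n ^ 3 + 30.
Proof.
apply: (@total_sum (DB 0) 4 4 _ _ _ _ _ 30); try exact: coord_dist_sym; try exact: coord_distxx.
- by move=> k i; rewrite /DB /coord_dist /gap /xB; lia.
- by move=> k; rewrite /DB /coord_dist /gap /xB; lia.
- rewrite !big_ord_recl !big_ord0; by vm_compute.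
- rewrite !big_ord_recl !big_ord0; by vm_compute.
Qed.

Lemma total_Bn1 n : 4 <= n -> 3 * (\sum_(i < n) \sum_(j < n) DB 1 i j) + 19 * n = n ^ 3 + 60.
Proof.
apply: (@total_sum (DB 1) 4 6 _ _ _ _ _ 60); try exact: coord_dist_sym; try exact: coord_distxx.
- by move=> k i; rewrite /DB /coord_dist /gap /xB; lia.
- by move=> k; rewrite /DB /coord_dist /gap /xB; lia.
- rewrite !big_ord_recl !big_ord0; by vm_compute.
- rewrite !big_ord_recl !big_ord0; by vm_compute.
Qed.

Lemma total_B1 n : 4 <= n -> 3 * (\sum_(i < n) \sum_(j < n) DB1 i j) + 19 * n = n ^ 3 + 54.
Proof.
apply: (@total_sum DB1 4 6 _ _ _ _ _ 54); try exact: DB1_sym; try exact: DB1xx.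
- by move=> [|[|[|[|k]]]] [|[|[|i]]] //= ? ?; rewrite /DB1 /gap; repeat case: ifP => /= ?; lia.
- by move=> [|[|[|[|k]]]] //= ?; rewrite /DB1 /gap; repeat case: ifP => /= ?; lia.
- rewrite !big_ord_recl !big_ord0; by vm_compute.
- rewrite !big_ord_recl !big_ord0; by vm_compute.
Qed.

Lemma column_lolli n : 2 <= n -> 2 * \sum_(i < n) Dlolli i n + 2 = n ^ 2 + n.
Proof.
apply: column_sum.
- by move=> k i; rewrite /Dlolli /coord_dist /gap /xlolli; lia.
- by move=> k; rewrite /Dlolli /coord_dist /gap /xlolli; lia.
- rewrite !big_ord_recl !big_ord0; by vm_compute.
Qed.

Lemma total_lolli n : 2 <= n ->
  3 * (\sum_(i < n) \sum_(j < n) Dlolli i j) + 7 * n = n ^ 3 + 12.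
Proof.
apply: (@total_sum Dlolli 2 2 _ _ _ _ _ 12); try exact: coord_dist_sym; try exact: coord_distxx.
- by move=> k i; rewrite /Dlolli /coord_dist /gap /xlolli; lia.
- by move=> k; rewrite /Dlolli /coord_dist /gap /xlolli; lia.
- rewrite !big_ord_recl !big_ord0; by vm_compute.
- rewrite !big_ord_recl !big_ord0; by vm_compute.
Qed.

(** [DBpq n] changes with n, so the recursion is used only once: removing the last vertex leaves the
    lollipop, and that vertex is a twin of its predecessor, with the same distances to the others
    and at distance 1 from it. *)
Lemma total_Bpq n : 5 <= n ->
  3 * (\sum_(i < n) \sum_(j < n) DBpq n i j) + 13 * n = n ^ 3 + 24.
Proof.
case: n => [|[|m]] // m3; rewrite total_rec; [|exact: coord_dist_sym|exact: coord_distxx].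
have -> : \sum_(i < m.+1) \sum_(j < m.+1) DBpq m.+2 i j =
    \sum_(i < m.+1) \sum_(j < m.+1) Dlolli i j.
  apply: eq_bigr => i _; apply: eq_bigr => j _; have := ltn_ord i; have := ltn_ord j.
  by rewrite /DBpq /Dlolli /coord_dist /gap /xBpq /xlolli; lia.
have -> : \sum_(i < m.+1) DBpq m.+2 i m.+1 = \sum_(i < m) Dlolli i m + 1.
  rewrite big_ord_recr /=; congr (_ + _).
    apply: eq_bigr => i _; have := ltn_ord i.
    by rewrite /DBpq /Dlolli /coord_dist /gap /xBpq /xlolli; lia.
  by rewrite /DBpq /coord_dist /gap /xBpq; lia.
have m2 : 2 <= m by lia.
by have := column_lolli m2; have := total_lolli (leqW m2); nia.
Qed.

Lemma column_Bn0 k : 3 <= k -> 2 * \sum_(i < k) DB 0 i k + 4 = k ^ 2 + k.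
Proof.
apply: column_sum.
- by move=> m i; rewrite /DB /coord_dist /gap /xB; lia.
- by move=> m; rewrite /DB /coord_dist /gap /xB; lia.
- rewrite !big_ord_recl !big_ord0; by vm_compute.
Qed.

Lemma row_Bn0 m k : 3 <= k -> k < m ->
  2 * \sum_(i < m) DB 0 k i + 4 = k ^ 2 + k + (m - 1 - k) * (m - k).
Proof.
move=> k3; elim: m => // m IHm; rewrite ltnS leq_eqVlt => /predU1P[<-|km].
  rewrite big_ord_recr /= [DB 0 k k]coord_distxx addn0.
  under eq_bigr do rewrite [DB 0 k _]coord_dist_sym.
  by rewrite column_Bn0 //; lia.
rewrite big_ord_recr /= mulnDr addnAC IHm //.
have -> : DB 0 k m = m - k by rewrite /DB /coord_dist /gap /xB; lia.
have [a mE] : exists a, m = k + a.+1 by exists (m - k - 1); lia.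
rewrite mE; have -> : k + a.+1 - 1 - k = a by lia.
have -> : k + a.+1 - k = a.+1 by lia.
have -> : (k + a.+1).+1 - 1 - k = a.+1 by lia.
have -> : (k + a.+1).+1 - k = a.+2 by lia.
by nia.
Qed.

Lemma row_Bn1 m : 4 <= m -> 2 * \sum_(i < m) DB 1 0 i + 3 * m = m ^ 2 + 6.
Proof.
elim: m => // m IHm; rewrite ltnS leq_eqVlt => /predU1P[<-|m4].
  by rewrite !big_ord_recl !big_ord0.
rewrite big_ord_recr /=; have -> : DB 1 0 m = m - 1 by rewrite /DB /coord_dist /gap /xB; lia.
by move: (IHm m4); move: (\sum_(_ < _) _) => s; nia.
Qed.

(** * Small orders by enumeration *)

Definition edge_rel (es : seq (nat * nat)) : rel nat :=
  fun i j => (i != j) && (((i, j) \in es) || ((j, i) \in es)).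

Definition sum2 k (F : nat -> nat -> nat) :=
  sumn [seq sumn [seq F i j | j <- iota 0 k] | i <- iota 0 k].

Lemma sum2E k (F : nat -> nat -> nat) : \sum_(i < k) \sum_(j < k) F i j = sum2 k F.
Proof.
have sE (f : nat -> nat) : \sum_(i < k) f i = sumn [seq f i | i <- iota 0 k].
  by rewrite sumnE big_map -[k in iota 0 k]subn0 -/(index_iota 0 k) big_mkord.
rewrite (sE (fun i => \sum_(j < k) F i j)); congr sumn; apply: eq_map => i.
exact: (sE (F i)).
Qed.

Fixpoint bitseqs k : seq bitseq :=
  if k is k'.+1 then [seq b :: m | b <- [:: true; false], m <- bitseqs k'] else [:: [::]].

Lemma mem_bitseqs m : m \in bitseqs (size m).
Proof. by elim: m => //= b m IHm; rewrite cats0 mem_cat; case: b; rewrite map_f ?orbT. Qed.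

Definition extend k (es : seq (nat * nat)) (m : bitseq) :=
  [seq (i, k) | i <- mask m (iota 0 k)] ++ es.

(* [has] and [all] evaluate both arguments of [orb] and [andb] under
   call-by-value; these variants stop at the first hit. *)
Definition hasb T (a : pred T) s := find a s < size s.
Definition allb T (a : pred T) s := size s <= find (predC a) s.

Lemma hasbE T (a : pred T) s : hasb a s = has a s.
Proof. by rewrite has_find. Qed.
Lemma allbE T (a : pred T) s : allb a s = all a s.
Proof. by rewrite /allb leqNgt -has_find has_predC negbK. Qed.

Definition same_rel k (e e' : rel nat) :=
  allb (fun i => allb (fun j => e i j == e' i j) (iota 0 k)) (iota 0 k).

Definition permutable k (e e' : rel nat) :=
  hasb (fun s => same_rel k e (fun i j => e' (nth 0 s i) (nth 0 s j))) (permutations (iota 0 k)).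

Lemma same_relP k e e' : same_rel k e e' -> forall i j, i < k -> j < k -> e i j = e' i j.
Proof.
rewrite /same_rel allbE => /allP h i j ik jk.
have := h i ltac:(by rewrite mem_iota); rewrite allbE => /allP/(_ j).
by rewrite mem_iota => /(_ jk)/eqP.
Qed.

Lemma shaped_permutable G k e e' : shaped G k e -> permutable k e e' -> shaped G k e'.
Proof.
case=> f fP; rewrite /permutable hasbE => /hasP[s]; rewrite mem_permutations => sP /same_relP se.
have s_size : size s = k by rewrite (perm_size sP) size_iota.
have s_uniq : uniq s by rewrite (perm_uniq sP) iota_uniq.
exists (nth 0 s \o f); apply: (labelled_shift fP) => [i ik|i j ik jk|i j ik jk].
- have : nth 0 s i \in s by rewrite mem_nth ?s_size.
  by rewrite (perm_mem sP) mem_iota.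
- by move/eqP; rewrite nth_uniq ?s_size // => /eqP.
- by rewrite se.
Qed.

(** The first conjunct makes [k] a fresh label; the second tries every nonempty neighbourhood for
    it. *)
Definition good_extension k (test : seq (nat * nat) -> bool) es :=
  all (fun p : nat * nat => (p.1 < k) && (p.2 < k)) es &&
  all (fun m => if has id m then test (extend k es m) else true) (bitseqs k).

(** Deleting a noncut vertex loses at least one edge, so the bound of k + 1 edges at order k passes
    down to smaller orders. *)
Definition representatives k (L : seq (seq (nat * nat))) := forall G : sgraph,
  connected G -> #|G| = k -> degsum G <= 2 * k.+1 ->
  exists2 es, es \in L & shaped G k (edge_rel es).

Lemma extension_test k L test (G : sgraph) : representatives k L -> 0 < k ->
  all (good_extension k test) L -> connected G -> #|G| = k.+1 -> degsum G <= 2 * k.+2 ->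
  exists2 es, test es & shaped G k.+1 (edge_rel es).
Proof.
move=> reps k0 /allP ok Gc Gk GS; have [|v dc] := exists_noncut Gc; first by rewrite Gk.
have dk : #|del v| = k by have := card_del v; lia.
have v0 : 0 < deg v by apply: deg_gt0; rewrite // Gk.
have [|es esL [f fP]] := reps _ dc dk; first by have := degsum_del v; lia.
have /andP[/allP es_lt /allP ext_ok] := ok es esL.
pose nbr i := [exists x : del v, (f x == i) && adj v (undel x)].
have nbrE x : nbr (f x) = adj v (undel x).
  case: fP => f_inj _ _ _; apply/existsP/idP => [[y /andP[/eqP/f_inj->]] //|vx].
  by exists x; rewrite eqxx.
pose m := map nbr (iota 0 k); exists (extend k es m).
  have := ext_ok m; rewrite -{1}(size_iota 0 k) -(size_map nbr) mem_bitseqs => /(_ isT).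
  suff -> : has id m by [].
  move: v0; rewrite degE => /card_gt0P[y]; rewrite inE => vy.
  have [|x xy] := @undelP _ v y; first by apply: contraTneq vy => ->; rewrite adj_irr.
  rewrite has_map; apply/hasP; exists (f x); last by rewrite /= nbrE xy.
  by rewrite mem_iota; case: fP => _ /(_ x).
have mem_new i j : ((i, j) \in [seq (i, k) | i <- mask m (iota 0 k)]) = [&& j == k, i < k & nbr i].
  rewrite /m -filter_mask; apply/mapP/and3P => [[i']|[/eqP-> ik ni]].
    by rewrite mem_filter mem_iota => /andP[ni ik] [-> ->].
  by exists i; rewrite // mem_filter ni mem_iota.
have not_old i : ((i, k) \in es = false) * ((k, i) \in es = false).
  by split; apply/negP => /es_lt /=; rewrite ltnn ?andbF.
have [||||f' [f'P _ _]] := labelled_extend (e' := edge_rel (extend k es m)) fP;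
  last (by exists f'); rewrite /edge_rel /extend.
- by move=> i j; rewrite eq_sym orbC.
- by rewrite eqxx.
- move=> i j ik jk; rewrite !mem_cat !mem_new.
  by rewrite (ltn_eqF ik) (ltn_eqF jk) /=.
- move=> x; case: fP => _ /(_ x) fx _ _; rewrite !mem_cat !mem_new !not_old eqxx fx nbrE.
  by rewrite [k == f x]eq_sym (ltn_eqF fx) /= orbF.
Qed.

Definition covered_by k L es :=
  if sum2 k (edge_rel es) <= 2 * k.+1 then
    hasb (fun es' => permutable k (edge_rel es) (edge_rel es')) L else true.

Lemma representatives_step k L L' : representatives k L -> 0 < k ->
  all (good_extension k (covered_by k.+1 L')) L -> representatives k.+1 L'.
Proof.
move=> reps k0 ok G Gc Gk GS; have [es] := extension_test reps k0 ok Gc Gk GS.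
move=> + esP; case: (esP) => f fP; rewrite /covered_by -sum2E -(labelled_degsum fP) GS hasbE.
by case/hasP=> es' es'L' /(shaped_permutable esP); exists es'.
Qed.

(** Candidate lists, whose completeness is certified by computation below. The last entry of [reps4]
    carries the labelling of [eB 0], on which [bicyclic4] relies. *)
Definition reps2 := [:: [:: (0,1)]].
Definition reps3 := [:: [:: (0,1); (0,2)]; [:: (0,1); (0,2); (1,2)]].
Definition reps4 := [:: [:: (0,1); (0,2); (0,3)]; [:: (0,1); (0,2); (1,3)];
  [:: (0,1); (0,2); (0,3); (1,3)]; [:: (0,1); (0,2); (1,3); (2,3)];
  [:: (0,1); (1,2); (2,3); (0,2); (1,3)]].
Definition reps5 := [:: [:: (0, 1); (0, 2); (0, 3); (0, 4)];
  [:: (0, 1); (0, 2); (0, 3); (1, 4)];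
  [:: (0, 1); (0, 2); (0, 3); (0, 4); (1, 4)];
  [:: (0, 1); (0, 2); (0, 3); (1, 4); (2, 4)];
  [:: (0, 1); (0, 2); (0, 3); (0, 4); (1, 4); (2, 4)];
  [:: (0, 1); (0, 2); (0, 3); (1, 4); (2, 4); (3, 4)];
  [:: (0, 1); (0, 2); (1, 3); (0, 4); (2, 4); (3, 4)];
  [:: (0, 1); (0, 2); (1, 3); (2, 4)];
  [:: (0, 1); (0, 2); (1, 3); (0, 4); (1, 4)];
  [:: (0, 1); (0, 2); (1, 3); (0, 4); (2, 4)];
  [:: (0, 1); (0, 2); (1, 3); (2, 4); (3, 4)];
  [:: (0, 1); (0, 2); (1, 3); (0, 4); (1, 4); (2, 4)];
  [:: (0, 1); (0, 2); (0, 3); (1, 3); (0, 4); (2, 4)]].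

Lemma representatives4 : representatives 4 reps4.
Proof.
have check1 : all (good_extension 1 (covered_by 2 reps2)) [:: [::]] by vm_compute.
have check2 : all (good_extension 2 (covered_by 3 reps3)) reps2 by vm_compute.
have check3 : all (good_extension 3 (covered_by 4 reps4)) reps3 by vm_compute.
refine (@representatives_step 3 reps3 reps4 _ isT check3); refine (@representatives_step 2 reps2 reps3 _ isT check2).
refine (@representatives_step 1 [:: [::]] reps2 _ isT check1).
move=> {check1 check2 check3} G _ G1 _; exists [::]; first by rewrite inE.
have all_eq (x y : G) : y = x.
  by have /card_le1_eqP/(_ x y isT isT) : #|G| <= 1 by rewrite G1.
exists (fun=> 0); split=> [x y _|x||x y] //.
by rewrite (all_eq x y) adj_irr.
Qed.

Lemma representatives5 : representatives 5 reps5.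
Proof.
have check4 : all (good_extension 4 (covered_by 5 reps5)) reps4 by vm_compute.
exact (representatives_step representatives4 isT check4).
Qed.

Lemma bicyclic4 (G : sgraph) : connected G -> #|G| = 4 -> degsum G = 10 -> shaped G 4 (eB 0).
Proof.
move=> Gc G4 GS; have [|es esL [f fP]] := representatives4 Gc G4; first by rewrite GS.
have : all (fun es => (sum2 4 (edge_rel es) == 10) ==> same_rel 4 (eB 0) (edge_rel es)) reps4.
  by vm_compute.
move/allP/(_ _ esL); rewrite -sum2E -(labelled_degsum fP) GS => /same_relP eE.
by exists f; apply: (labelled_ext fP).
Qed.

(** The ball of radius [r]. The table built from it is only a candidate: [metric_onb] certifies it,
    so the search itself needs no correctness proof. *)
Definition reach k es r i :=
  iter r (fun s => [seq j <- iota 0 k | has (fun l => (l == j) || edge_rel es l j) s]) [:: i].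
Definition bfs_table k es :=
  [seq [seq find (fun r => j \in reach k es r i) (iota 0 k) | j <- iota 0 k] | i <- iota 0 k].
Definition lookup (t : seq (seq nat)) i j := nth 0 (nth [::] t i) j.

Definition metric_onb n (e : rel nat) (D : nat -> nat -> nat) :=
  all (fun i => [&& D i i == 0,
    all (fun j => all (fun k => e j k ==> (D i k <= (D i j).+1)) (iota 0 n)) (iota 0 n) &
    all (fun j => (j != i) ==> has (fun k => e k j && (D i k < D i j)) (iota 0 n)) (iota 0 n)])
  (iota 0 n).

Lemma metric_onP n e D : metric_onb n e D -> metric_on n e D.
Proof.
move=> /allP h i ilt; have in_iota k : (k \in iota 0 n) = (k < n) by rewrite mem_iota.
have /and3P[/eqP Dii /allP lip /allP dec] := h i ltac:(by rewrite in_iota).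
split=> // [j k jlt klt|j jlt].
  by have /allP/(_ k) := lip j ltac:(by rewrite in_iota); rewrite in_iota => /(_ klt)/implyP.
have := dec j; rewrite in_iota => /(_ jlt)/implyP + ji => /(_ ji)/hasP[k].
by rewrite in_iota => klt /andP[ek Dk]; exists k.
Qed.

Definition small_table k (e : rel nat) t b :=
  metric_onb k e (lookup t) && (sum2 k (lookup t) <= b).

(** 14 is twice the 7 edges, and 50 is 2 thr(6). *)
Definition test6 es := if sum2 6 (edge_rel es) == 14 then
    if small_table 6 (edge_rel es) (bfs_table 6 es) 50 then true else
    hasb (fun e => permutable 6 (edge_rel es) e) [:: eB 0; eB 1; eB1; eBpq 6]
  else true.

Lemma bicyclic6 (G : sgraph) : connected G -> #|G| = 6 -> degsum G = 14 ->
  dsum2 G <= 50 \/ [\/ shaped G 6 (eB 0), shaped G 6 (eB 1), shaped G 6 eB1 | shaped G 6 (eBpq 6)].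
Proof.
move=> Gc G6 GS; have GS' : degsum G <= 2 * 7 by rewrite GS.
have check5 : all (good_extension 5 test6) reps5 by vm_compute.
have [es] := extension_test representatives5 isT check5 Gc G6 GS'; move=> {check5 GS'}.
move=> + esP; case: (esP) => f fP; rewrite /test6 -sum2E -(labelled_degsum fP) GS eqxx.
case: ifP => [/andP[/metric_onP tP]|_].
  by rewrite -sum2E -(labelled_dsum2 fP tP); left.
have some_shape (P : pred (rel nat)) : (forall e, P e -> shaped G 6 e) ->
    has P [:: eB 0; eB 1; eB1; eBpq 6] ->
    [\/ shaped G 6 (eB 0), shaped G 6 (eB 1), shaped G 6 eB1 | shaped G 6 (eBpq 6)].
  by move=> PG /=; rewrite orbF => /or4P[] /PG;
    [constructor 1|constructor 2|constructor 3|constructor 4].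
by rewrite hasbE => ex; right; apply: some_shape ex => e; apply: shaped_permutable esP.
Qed.

(** * Adding a pendant vertex *)

Lemma eB_new s m i : s + 4 <= m -> i < m -> eB s m i = (i == m.-1).
Proof. by move=> sm im; rewrite /eB /consecutive /chord; lia. Qed.

Lemma eB_irr s i : eB s i i = false.
Proof. by rewrite /eB /consecutive /chord; lia. Qed.

Lemma eB1_new m i : 4 <= m -> i < m -> eB1 m i = (i == m.-1).
Proof. by move: m i => [|[|[|[|m]]]] // i _ im; rewrite /eB1 /consecutive /chord /=; lia. Qed.

Lemma labelled_B_tail (G : sgraph) (v : G) (u : del v) m s f : s + 4 <= m ->
  (forall x, adj v x = (x == undel u)) -> labelled m (eB s) f -> f u = m.-1 ->
  exists f' : G -> nat, labelled m.+1 (eB s) f' /\ f' v = m.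
Proof.
move=> sm vu fP fu; have [|||i im|f' [f'P f'v _]] := labelled_pendant (e' := eB s) fP vu.
- exact: eB_sym.
- exact: eB_irr.
- by [].
- by rewrite fu eB_new.
- by exists f'.
Qed.

(** The new vertex first receives label [m], next to 0; moving it to the front shifts all other
    labels by one and turns [eB s] into [eB s.+1]. *)
Lemma shaped_B_head (G : sgraph) (v : G) (u : del v) m s f : s + 4 <= m ->
  (forall x, adj v x = (x == undel u)) -> labelled m (eB s) f -> f u = 0 ->
  shaped G m.+1 (eB s.+1).
Proof.
move=> sm vu fP fu.
pose e' i j := (i < m) && (j < m) && eB s i j || chord m 0 i j.
have [|||i im|f' [f'P f'v _]] := labelled_pendant (e' := e') fP vu.
- by move=> i j; rewrite /e' chordC eB_sym [(i < m) && _]andbC.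
- by rewrite /e' ltnn /chord; lia.
- by move=> i j im jm; rewrite /e' im jm /chord; lia.
- by rewrite fu /e' ltnn /chord; lia.
pose h i := if i == m then 0 else i.+1.
exists (h \o f'); apply: (labelled_shift f'P) => [i|i j|i j] im; rewrite /h.
- by case: eqP; lia.
- by move=> jm; case: eqP; case: eqP; lia.
- move=> jm; rewrite /e' /eB /consecutive /chord.
  by case: (eqVneq i m) => mi; case: (eqVneq j m) => mj; lia.
Qed.

(** The bound is the one that makes n + D(u) at most thr(n + 1) - thr(n). It is inherited through
    pendant vertices and holds at degree at least 2 from order 5 on; in K4 minus an edge it fails
    only at the two degree-2 vertices, from which the tail of B(n,0) grows. *)
Lemma tail_or_small (G : sgraph) (u : G) : connected G -> degsum G = 2 * #|G| + 2 ->
  2 * dsum u + #|G| + 6 <= #|G| ^ 2 \/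
  exists f : G -> nat, labelled #|G| (eB 0) f /\ f u = #|G|.-1.
Proof.
have [n] := ubnP #|G|; elim: n G u => [|n IHn] G u Gn Gc GS; first by rewrite ltn0 in Gn.
have G4 : 4 <= #|G|.
  have : degsum G <= #|G| * (#|G|.-1).
    rewrite /degsum -sum_nat_const; apply: leq_sum => x _.
    by rewrite -(far0 Gc x) /= -(far1 Gc) leq_addr.
  by rewrite GS; case: #|G| Gc.1 => [|[|[|[|m]]]] //=; lia.
have deg_lt : deg u < #|G| by rewrite -(far0 Gc u) ltnS -(far1 Gc) leq_addr.
have [E4|N4] := eqVneq #|G| 4.
  have [|f fP] := bicyclic4 Gc E4; first by rewrite GS E4.
  have fu : f u < 4 by case: fP.
  rewrite (labelled_dsum fP (metric_B _)) // E4.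
  have [fu3|fu3] := eqVneq (f u) 3; first by right; exists f.
  have [fu0|fu0] := eqVneq (f u) 0.
    right; exists ((fun i => 3 - i) \o f); split; last by rewrite /= fu0.
    apply: (labelled_shift fP) => [i i4|i j i4 j4|i j i4 j4]; [lia|lia|].
    by move: i j i4 j4 => [|[|[|[|i]]]] [|[|[|[|j]]]].
  left; move: fu fu3 fu0; case: (f u) => [|[|[|[|k]]]] // _ _ _;
    by rewrite !big_ord_recl !big_ord0.
have [u1|u2] := leqP (deg u) 1; last first.
  left; have := @dsum_le_deg _ Gc u 2 u2; have [m ->] : exists m, #|G| = m + 5.
    by exists (#|G| - 5); lia.
  by move=> /(_ ltac:(lia)); nia.
have {}u1 : deg u = 1 by have := @deg_gt0 _ u Gc; lia.
have dc := connected_del_pendant Gc u1; have cd := card_del u.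
have [z zE] := deg1P u1; have uz : adj u z by rewrite zE.
have [|y yE] := @undelP _ u z; first by apply: contraTneq uz => ->; rewrite adj_irr.
rewrite -yE in uz zE; have := dsum_pendant Gc dc uz.
have dn : #|del u| < n by lia.
have dS : degsum (del u) = 2 * #|del u| + 2 by have := degsum_del u; lia.
have [small|[f [fP fy]]] := IHn _ y dn dc dS; first by left; rewrite -cd; nia.
have d4 : 0 + 4 <= #|del u| by lia.
move=> _; right; have [f' [f'P f'u]] := labelled_B_tail d4 zE fP fy.
by exists f'; rewrite -cd.
Qed.

(** B(8,2) has Wiener index 69 = thr(8) + 1, so it has to be listed at order 8. *)
Definition exceptional (G : sgraph) n :=
  [\/ shaped G n (eB 0), shaped G n (eB 1), shaped G n eB1 | shaped G n (eBpq n)] \/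
  n = 8 /\ shaped G 8 (eB 2).

Section PendantStep.
Variables (G : sgraph) (v : G) (u : del v) (m : nat).
Hypotheses (Gc : connected G) (v1 : deg v = 1) (vu : forall x, adj v x = (x == undel u)).
Hypotheses (dm : #|del v| = m) (m6 : 6 <= m) (GS : degsum G = 2 * #|G| + 2).

Let dc : connected (del v) := connected_del_pendant Gc v1.

Lemma small_of_pendant :
  3 * dsum2 (del v) + 6 * m + 6 * dsum u + 19 * m.+1 <= m.+1 ^ 3 + 48 -> wiener_small G.
Proof.
have := dsum2_del Gc dc; have := @dsum_pendant _ Gc _ dc u; rewrite vu eqxx => /(_ isT).
by rewrite /wiener_small -(card_del v) dm; lia.
Qed.

Let pendant_deg2 : 2 <= deg u -> 2 * dsum u + 3 * m <= m ^ 2 + 4.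
Proof.
move=> u2; have := @dsum_le_deg _ dc u 2 u2; rewrite dm => /(_ ltac:(lia)).
have [a ->] : exists a, m = a + 6 by exists (m - 6); lia.
by nia.
Qed.

Let deg2_of f e : labelled m e f -> forall i j, i != j -> i < m -> j < m ->
  e (f u) i -> e (f u) j -> 2 <= deg u.
Proof.
move=> fP i j ij im jm ei ej; apply: (labelled_deg_ge (s := [:: i; j]) fP).
  by rewrite /= inE ij.
by rewrite /= im jm ei ej.
Qed.

(** Attaching at the tip gives B(m+1,0), at vertex 0 it gives B(m+1,1). Elsewhere 2 D(u) + 3m <= m^2
    is required, with equality next to the tip. *)
Lemma pendant_Bn0 : shaped (del v) m (eB 0) -> wiener_small G \/ exceptional G m.+1.
Proof.
case=> f fP; have fm : f u < m by case: fP.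
have Df := metric_B (s := 0) (n := m) ltac:(lia).
have tot := total_Bn0 (n := m) ltac:(lia).
have [ftail|ftail] := eqVneq (f u) m.-1.
  have [|f' [f'P _]] := labelled_B_tail _ vu fP ftail; first by lia.
  by right; left; constructor 1; exists f'.
have [fhead|fhead] := eqVneq (f u) 0.
  by right; left; constructor 2; apply: shaped_B_head vu fP fhead; lia.
left; apply: small_of_pendant; rewrite (labelled_dsum2 fP Df).
suff : 2 * dsum u + 3 * m <= m ^ 2 by nia.
have [f3|f3] := leqP 3 (f u); last first.
  have d3 : 3 <= deg u.
    have [f1|f2] : f u = 1 \/ f u = 2 by lia.
      apply: (labelled_deg_ge (s := [:: 0; 2; 3]) fP) => //=.
      by rewrite f1 /eB /consecutive /chord /= !andbT; lia.
    apply: (labelled_deg_ge (s := [:: 0; 1; 3]) fP) => //=.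
    by rewrite f2 /eB /consecutive /chord /= !andbT; lia.
  have := @dsum_le_deg _ dc u 3 d3; rewrite dm => /(_ ltac:(lia)).
  have [a ->] : exists a, m = a + 6 by exists (m - 6); lia.
  by nia.
rewrite (labelled_dsum fP Df); have := row_Bn0 f3 fm.
have [a mE] : exists a, m = f u + a + 2 by exists (m - f u - 2); lia.
rewrite [in (m - 1 - f u)]mE [in (m - f u)]mE.
have -> : f u + a + 2 - 1 - f u = a.+1 by lia.
have -> : f u + a + 2 - f u = a.+2 by lia.
move: (\sum_(_ < m) _) => t; move: (f u) f3 mE => k k3 ->; nia.
Qed.

Lemma pendant_Bn1 : shaped (del v) m (eB 1) -> wiener_small G \/ exceptional G m.+1.
Proof.
case=> f fP; have fm : f u < m by case: fP.
have Df := metric_B (s := 1) (n := m) ltac:(lia).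
have tot := total_Bn1 (n := m) ltac:(lia).
have [ftail|ftail] := eqVneq (f u) m.-1.
  have [|f' [f'P _]] := labelled_B_tail _ vu fP ftail; first by lia.
  by right; left; constructor 2; exists f'.
have [fhead|fhead] := eqVneq (f u) 0.
  (* Attaching at the head gives B(m+1,2): small for m >= 8, the exceptional B(8,2) for m = 7, and
     the mirror image of B(7,1) for m = 6. *)
  have [m8|m8] := leqP 8 m.
    left; apply: small_of_pendant; rewrite (labelled_dsum2 fP Df) (labelled_dsum fP Df) fhead.
    have := row_Bn1 (m := m) ltac:(lia); move: (\sum_(_ < m) DB 1 0 _) => t.
    by nia.
  have GB : shaped G m.+1 (eB 2) by apply: shaped_B_head vu fP fhead; lia.
  have [mE|mE] : m = 7 \/ m = 6 by lia.
    by right; right; rewrite mE in GB *.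
  right; left; constructor 2; rewrite mE in GB *; case: GB => g gP.
  exists ((fun i => 6 - i) \o g); apply: (labelled_shift gP) => [i i7|i j i7 j7|i j i7 j7]; [lia|lia|].
  by move: i j i7 j7 => [|[|[|[|[|[|[|i]]]]]]] [|[|[|[|[|[|[|j]]]]]]].
left; apply: small_of_pendant; rewrite (labelled_dsum2 fP Df).
have [m7|m7] := leqP 7 m.
  have := pendant_deg2 (deg2_of fP (i := (f u).-1) (j := (f u).+1) _ _ _ _ _).
  move=> /(_ ltac:(lia) ltac:(lia) ltac:(lia)).
  move=> /(_ ltac:(rewrite /eB /consecutive; lia) ltac:(rewrite /eB /consecutive; lia)).
  by nia.
(* Here the degree bound gives only D(u) <= 11 where 10 is required, so the interior vertices are
   checked one by one. *)
have mE : m = 6 by lia.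
have : dsum u <= 10; last by rewrite mE in tot *; lia.
rewrite (labelled_dsum fP Df) mE; rewrite mE in fm ftail.
move: fm ftail fhead; case: (f u) => [|[|[|[|[|[|k]]]]]] // _ _ _;
  by rewrite !big_ord_recl !big_ord0.
Qed.

Lemma pendant_B1 : shaped (del v) m eB1 -> wiener_small G \/ exceptional G m.+1.
Proof.
case=> f fP; have fm : f u < m by case: fP.
have Df := metric_B1 (n := m) ltac:(lia).
have tot := total_B1 (n := m) ltac:(lia).
have [ftail|ftail] := eqVneq (f u) m.-1.
  have [|||i im|f' [f'P f'v _]] := labelled_pendant (e' := eB1) fP vu.
  - exact: eB1_sym.
  - by rewrite /eB1 /consecutive /chord; lia.
  - by [].
  - by rewrite ftail eB1_new //; lia.
  - by right; left; constructor 3; exists f'.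
left; apply: small_of_pendant; rewrite (labelled_dsum2 fP Df).
suff /pendant_deg2 : 2 <= deg u by nia.
have [f2|f2] := leqP 2 (f u).
  by apply: (deg2_of fP (i := (f u).-1) (j := (f u).+1));
    rewrite /eB1 /consecutive /chord; lia.
by apply: (deg2_of fP (i := 2) (j := 3)) => //; rewrite /eB1 /consecutive /chord; lia.
Qed.

(** No vertex of B_m^{3,3} is pendant and no distance exceeds m - 3, so every place of attachment
    satisfies [dsum_le_deg2_short]. *)
Lemma pendant_Bpq : shaped (del v) m (eBpq m) -> wiener_small G.
Proof.
case=> f fP; have fm : f u < m by case: fP.
have Df := metric_Bpq (n := m) ltac:(lia).
have tot := total_Bpq (n := m) ltac:(lia).
apply: small_of_pendant; rewrite (labelled_dsum2 fP Df).
suff : 2 * dsum u + 3 * m <= m ^ 2 + 2 by nia.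
rewrite -dm; apply: dsum_le_deg2_short => //; try by rewrite dm; lia.
  have [f0|f0] := eqVneq (f u) 0.
    by apply: (deg2_of fP (i := 1) (j := 2)) => //; rewrite ?f0 /eBpq /consecutive /chord; lia.
  have [f1|f1] := eqVneq (f u) m.-1.
    by apply: (deg2_of fP (i := m - 2) (j := m - 3));
      rewrite ?f1 /eBpq /consecutive /chord; lia.
  by apply: (deg2_of fP (i := (f u).-1) (j := (f u).+1));
    rewrite /eBpq /consecutive /chord; lia.
move=> x; rewrite (labelled_dist fP Df) dm /DBpq /coord_dist /gap /xBpq.
have fx : f x < m by case: fP.
by clear -fm fx m6; lia.
Qed.

(** The largest distance sum in B(8,2) is 24, and 69 + 8 + 24 = 101 = thr(9). *)
Lemma pendant_B82 : m = 8 -> shaped (del v) 8 (eB 2) -> wiener_small G.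
Proof.
move=> mE [f fP]; have fm : f u < 8 by case: fP.
have Df := metric_B (s := 2) (n := 8) isT.
apply: small_of_pendant; rewrite (labelled_dsum2 fP Df) (labelled_dsum fP Df) mE.
have -> : \sum_(i < 8) \sum_(j < 8) DB 2 i j = 138 by rewrite !big_ord_recl !big_ord0.
suff : \sum_(i < 8) DB 2 (f u) i <= 24 by lia.
by move: fm; case: (f u) => [|[|[|[|[|[|[|[|k]]]]]]]] // _; rewrite !big_ord_recl !big_ord0.
Qed.

Lemma pendant_step : wiener_small (del v) \/ exceptional (del v) m ->
  wiener_small G \/ exceptional G m.+1.
Proof.
case=> [small|[[]|[mE]]].
- have dS : degsum (del v) = 2 * #|del v| + 2.
    by have := degsum_del v; have := card_del v; lia.
  have [du|[f [fP fu]]] := tail_or_small u dc dS; last first.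
    have [|f' [f'P _]] := labelled_B_tail _ vu fP fu; first by lia.
    by right; left; constructor 1; exists f'; rewrite -dm.
  by left; apply: small_of_pendant; move: small du; rewrite /wiener_small dm; nia.
- exact: pendant_Bn0.
- exact: pendant_Bn1.
- exact: pendant_B1.
- by move/pendant_Bpq; left.
- by move/(pendant_B82 mE); left.
Qed.

End PendantStep.

(** * Two triangles joined by a path *)

Lemma deg2_adj (G : sgraph) (x a c : G) : deg x = 2 -> a != c -> adj x a -> adj x c ->
  forall y, adj x y = (y == a) || (y == c).
Proof.
move=> x2 ac xa xc; have [p [q [_ E]]] := deg2P x2.
move=> y; move: xa xc ac; rewrite !E.
by case/orP=> /eqP-> /orP[]/eqP->; rewrite ?eqxx // orbC.
Qed.

Lemma elolli_irr i : elolli i i = false.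
Proof. by rewrite /elolli /consecutive /chord; lia. Qed.

Lemma elolli_new m i : 3 <= m -> i < m -> elolli m i = (i == m.-1).
Proof. by rewrite /elolli /consecutive /chord; lia. Qed.

Lemma eBpq_irr n i : 3 <= n -> eBpq n i i = false.
Proof. by rewrite /eBpq /consecutive /chord; lia. Qed.

Lemma eBpq_lollipop m i j : i < m.+1 -> j < m.+1 -> eBpq m.+2 i j = elolli i j.
Proof. by rewrite /eBpq /elolli /consecutive /chord subn1; lia. Qed.

Lemma eBpq_new m i : 3 <= m -> i < m.+1 -> eBpq m.+2 m.+1 i = (i == m.-1) || (i == m).
Proof. by rewrite /eBpq /consecutive /chord; lia. Qed.

(* Peeling pendant vertices off the tail, starting from the tip u, until only the
   triangle {b, q, p} is left. *)
Lemma lollipop_shape (G : sgraph) (u b q p : G) : connected G ->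
  [/\ b != q, b != p & q != p] -> [/\ adj b q, adj b p & adj q p] ->
  deg b = 2 -> deg q = 2 -> u != b -> u != q ->
  (u = p /\ deg p = 2) \/ [/\ u != p, deg u = 1 & deg p = 3] ->
  (forall x, x != u -> x != b -> x != q -> x != p -> deg x = 2) ->
  exists f : G -> nat, labelled #|G| elolli f /\ f u = #|G|.-1.
Proof.
have [n] := ubnP #|G|; elim: n G u b q p => [|n IHn] G u b q p Gn Gc; first by rewrite ltn0 in Gn.
move=> [bq bp qp] [abq abp aqp] b2 q2 ub uq up other2.
have badj := deg2_adj b2 qp abq abp.
have qadj x : adj q x = (x == b) || (x == p).
  by apply: (deg2_adj q2) => //; rewrite adj_sym.
case: up => [[E p2]|[up u1 p3]].
  have padj x : adj p x = (x == b) || (x == q).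
    by apply: (deg2_adj p2) => //; rewrite adj_sym.
  (* The triangle is closed under adjacency, hence it is all of [G]. *)
  have all3 x : [|| x == b, x == q | x == p].
    have [k] := ubnP (dist b x); elim: k x => // k IHk x kx.
    have [->|xb] := eqVneq x b; first by [].
    have [|y yx dx] := @dist_parent _ Gc b x; first by rewrite eq_sym.
    have : [|| y == b, y == q | y == p] by apply: IHk; rewrite dx in kx.
    case/or3P=> /eqP yE.
    - by move: yx; rewrite yE badj => /orP[]->; rewrite ?orbT.
    - by move: yx; rewrite yE qadj (negPf xb) /= => ->; rewrite orbT.
    - by move: yx; rewrite yE padj (negPf xb) /= => ->.
  have G3 : #|G| = 3.
    have <- : #|b |: [set q; p]| = 3 by rewrite cardsU1 cards2 !inE negb_or bq bp qp.
    by apply: eq_card => x; rewrite !inE; have := all3 x; rewrite -/(_ || _) => ->.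
  exists (fun x => if x == b then 0 else if x == q then 1 else 2).
  rewrite G3 E ![p == _]eq_sym (negPf bp) (negPf qp); split=> //; split=> // [x y|x|x y].
  - by case/or3P: (all3 x) => /eqP->; case/or3P: (all3 y) => /eqP->;
      rewrite ?eqxx ?(negPf bq) ?(negPf bp) ?(negPf qp) ?[q == b]eq_sym ?[p == _]eq_sym
        ?(negPf bq) ?(negPf bp) ?(negPf qp).
  - by case: ifP => // _; case: ifP.
  - by case/or3P: (all3 x) => /eqP->; case/or3P: (all3 y) => /eqP->;
      rewrite ?badj ?qadj ?padj ?eqxx ?[q == b]eq_sym ?[p == _]eq_sym
        ?(negPf bq) ?(negPf bp) ?(negPf qp).
have dc := connected_del_pendant Gc u1; have cd := card_del u.
have [z uz] := deg1P u1.
have [b' bE] := @undelP _ u b ltac:(by rewrite eq_sym).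
have [q' qE] := @undelP _ u q ltac:(by rewrite eq_sym).
have [p' pE] := @undelP _ u p ltac:(by rewrite eq_sym).
have zu : z != u by apply/eqP => E; have := uz z; rewrite E adj_irr eqxx.
have [z' zE] := undelP zu.
have adju x : adj x u = (x == z) by rewrite adj_sym uz.
have zb : z != b by apply/eqP => E; have := badj u; rewrite -E adj_sym uz eqxx (negPf uq) (negPf up).
have zq : z != q by apply/eqP => E; have := qadj u; rewrite -E adj_sym uz eqxx (negPf ub) (negPf up).
have deg' (x : del u) : deg x = deg (undel x) - (undel x == z).
  by rewrite -(deg_del x) adju addnK.
have neq' (x y : del u) : (x == y) = (undel x == undel y) by rewrite (inj_eq (@undel_inj _ u)).
(* The neighbour [z] of [u] is the new tip: either it is [p], whose degree drops to 2, or a path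
   vertex that becomes pendant. *)
have [|||||||||f [fP fz]] := IHn (del u) z' b' q' p' _ dc.
- by rewrite -ltnS cd.
- by rewrite !neq' bE qE pE.
- by rewrite !adj_del bE qE pE.
- by rewrite deg' bE b2 [b == z]eq_sym (negPf zb).
- by rewrite deg' qE q2 [q == z]eq_sym (negPf zq).
- by rewrite neq' zE bE.
- by rewrite neq' zE qE.
- have [zp|zp] := eqVneq z p; [left|right].
    by split; [apply: undel_inj; rewrite zE pE | rewrite deg' pE p3 zp eqxx].
  rewrite neq' zE pE !deg' zE pE eqxx p3 [p == z]eq_sym (negPf zp).
  by rewrite (other2 z) //.
- move=> x; rewrite !neq' zE bE qE pE deg' => xz xb xq xp.
  by rewrite (negPf xz) other2 // undel_neq.
have d3 : 3 <= #|del u|.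
  have <- : #|b' |: [set q'; p']| = 3 by rewrite cardsU1 cards2 !inE negb_or !neq' bE qE pE bq bp qp.
  exact: max_card.
have [|||i im|f' [f'P f'u _]] := labelled_pendant (e' := elolli) (u := z') fP _ elolli_sym.
- by move=> x; rewrite uz zE.
- exact: elolli_irr.
- by [].
- by rewrite fz elolli_new.
by exists f'; rewrite -cd.
Qed.

(** The vertices [p] and [p'] of degree 3 use up the whole excess of the degree sum over 2n, so all
    others have degree 2. Deleting the tips [v] and [q] of one triangle leaves a lollipop with
    pendant end [p]; putting back [q], then [v], gives them the last two labels. *)
Lemma two_triangles_shape (G : sgraph) (v b : G) : connected G -> degsum G = 2 * #|G| + 2 ->
  (forall x : G, 2 <= deg x) -> v != b -> adj v b = false ->
  triangle_end v -> triangle_end b -> shaped G #|G| (eBpq #|G|).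
Proof.
move=> Gc GS deg2 vb nvb [p [q [pq vadj qadj q2 p3]]] [p' [q' [p'q' badj q'adj q'2 p'3]]].
have v2 : deg v = 2.
  by apply: (@deg_seq _ v [:: p; q]) => [|x]; rewrite /= ?inE ?pq ?vadj.
have b2 : deg b = 2.
  by apply: (@deg_seq _ b [:: p'; q']) => [|x]; rewrite /= ?inE ?p'q' ?badj.
have vp : adj v p by rewrite vadj eqxx.
have vq : adj v q by rewrite vadj eqxx orbT.
have bp' : adj b p' by rewrite badj eqxx.
have bq' : adj b q' by rewrite badj eqxx orbT.
have qp : adj q p by rewrite qadj eqxx.
have qp'_ : adj q' p' by rewrite q'adj eqxx.
have adj_neq (x y : G) : adj x y -> x != y by move=> xy; apply/eqP => E; rewrite E adj_irr in xy.
have deg_neq (x y : G) : deg x <> deg y -> x != y by move=> xy; apply/eqP => E; rewrite E in xy.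
have bp : b != p by apply: deg_neq; rewrite b2 p3.
have vp' : v != p' by apply: deg_neq; rewrite v2 p'3.
have qp'n : q != p' by apply: deg_neq; rewrite q2 p'3.
have q'p : q' != p by apply: deg_neq; rewrite q'2 p3.
have bq : b != q by apply/eqP => E; rewrite E vq in nvb.
have vq' : v != q' by apply/eqP => E; rewrite E adj_sym bq' in nvb.
have qq' : q != q'.
  apply/eqP => E; have := qadj b; rewrite E adj_sym bq' (negPf bp).
  by rewrite [b == v]eq_sym (negPf vb).
(* If both triangles hung at [p], it would have the four neighbours [v], [q], [b], [q']. *)
have pp' : p != p'.
  apply/eqP => E.
  have : size [:: v; q; b; q'] <= deg p.
    apply: deg_ge_seq; rewrite /=.
      by rewrite !inE !negb_or (adj_neq _ _ vq) vb vq' [q == b]eq_sym bq qq' (adj_neq _ _ bq').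
    by rewrite ![adj p _]adj_sym vp qp E bp' qp'_.
  by rewrite p3.
have rest2 x : x != p -> x != p' -> deg x = 2.
  move=> xp xp'; have : \sum_(y : G) (deg y - 2) = 2.
    have : \sum_(y : G) (deg y - 2 + 2) = 2 * #|G| + 2.
      by rewrite -GS; apply: eq_bigr => y _; rewrite subnK.
    by rewrite big_split /= sum_nat_const (_ : #|xpredT| = #|G|) //; move: #|G|; clear; lia.
  rewrite (bigD1 p) //= (bigD1 p') 1?eq_sym //= (bigD1 x) ?xp //= p3 p'3.
  by move: (deg2 x); clear; lia.
have vc : connected (del v).
  apply: (@connected_del _ v p (dist p)); first by rewrite eq_sym adj_neq.
  move=> y yv yp; have [|y' y'y dy] := @dist_parent _ Gc p y; first by rewrite eq_sym.
  have [E|y'v] := eqVneq y' v; last by exists y'; rewrite y'y y'v dy.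
  have yq : y = q by move: y'y; rewrite E vadj (negPf yp) => /eqP.
  exists p; rewrite yq adj_sym qp adj_neq 1?adj_sym // distxx dist_gt0 // pq.
have q_v : q != v by rewrite eq_sym adj_neq.
have [q1 q1E] := undelP q_v.
have p_v : p != v by rewrite eq_sym adj_neq.
have [p1 p1E] := undelP p_v.
have adjv x : adj x v = (x == p) || (x == q) by rewrite adj_sym vadj.
have adjq x : adj x q = (x == p) || (x == v) by rewrite adj_sym qadj.
have deg_v (x : del v) : deg x = deg (undel x) - ((undel x == p) || (undel x == q)).
  by rewrite -(deg_del x) adjv addnK.
(* Once [v] is gone, its twin [q] is pendant. *)
have q1_deg : deg q1 = 1 by rewrite deg_v q1E q2 eqxx orbT.
have q1c := connected_del_pendant vc q1_deg.
have lift2 (x : G) : x != v -> x != q -> exists y : del q1, undel (undel y) = x.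
  move=> xv xq; have [x1 x1E] := undelP xv.
  have [|x2 x2E] := @undelP _ q1 x1; last by exists x2; rewrite x2E.
  by apply/eqP => E; rewrite -x1E E q1E eqxx in xq.
have [p2 p2E] := lift2 p p_v pq.
have [b0 bE] := lift2 b ltac:(by rewrite eq_sym) bq.
have [p0 p0E] := lift2 p' ltac:(by rewrite eq_sym) ltac:(by rewrite eq_sym).
have [q0 q0E] := lift2 q' ltac:(by rewrite eq_sym) ltac:(by rewrite eq_sym).
have inj2 (x y : del q1) : (x == y) = (undel (undel x) == undel (undel y)).
  by rewrite (inj_eq (@undel_inj _ v)) (inj_eq (@undel_inj _ q1)).
have deg_q (x : del q1) : deg x = deg (undel (undel x)) - 2 * (undel (undel x) == p).
  have := deg_del x; have := deg_del (undel x); rewrite adj_del q1E adjv adjq.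
  have -> : (undel (undel x) == q) = false.
    by rewrite -q1E (inj_eq (@undel_inj _ v)); apply: negPf; apply: undel_neq.
  have -> : (undel (undel x) == v) = false by apply: negPf; apply: undel_neq.
  by rewrite !orbF; clear; lia.
have [||||||||f [fP fp]] := @lollipop_shape (del q1) p2 b0 q0 p0 q1c.
- by rewrite !inj2 bE q0E p0E (adj_neq _ _ bq') (adj_neq _ _ bp') (adj_neq _ _ qp'_).
- by rewrite !adj_del bE q0E p0E.
- by rewrite deg_q bE b2 (negPf bp).
- by rewrite deg_q q0E q'2 (negPf q'p).
- by rewrite inj2 p2E bE eq_sym.
- by rewrite inj2 p2E q0E eq_sym.
- by right; rewrite inj2 !deg_q p2E p0E pp' p3 p'3 eqxx [p' == p]eq_sym (negPf pp').
- move=> x; rewrite !inj2 deg_q p2E bE q0E p0E => xp xb xq xp'.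
  by rewrite (negPf xp) rest2.
set m := #|del q1| in fP fp.
have m3 : 3 <= m.
  have <- : #|b0 |: [set q0; p0]| = 3.
    rewrite cardsU1 cards2 !inE negb_or !inj2 bE q0E p0E.
    by rewrite (adj_neq _ _ bq') (adj_neq _ _ bp') (adj_neq _ _ qp'_).
  exact: max_card.
have [|||i im|g [gP gq gE]] := labelled_pendant (e' := elolli) (u := p2) fP _ elolli_sym.
- move=> x; rewrite adj_del q1E qadj -p2E (inj_eq (@undel_inj _ v)).
  by rewrite (negPf (undel_neq x)) orbF.
- exact: elolli_irr.
- by [].
- by rewrite fp elolli_new.
have nE : #|G| = m.+2 by rewrite -(card_del v) -(card_del q1).
have gp : g p1 = m.-1.
  have -> : p1 = undel p2 by apply: undel_inj; rewrite p1E p2E.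
  by rewrite gE.
have g_inj : injective g by case: gP.
have [||||h [hP _ _]] := labelled_extend (e' := eBpq m.+2) gP.
- exact: eBpq_sym.
- exact: eBpq_irr (leqW (leqW m3)).
- exact: eBpq_lollipop.
- move=> x; rewrite vadj -p1E -q1E !(inj_eq (@undel_inj _ v)) -!(inj_eq g_inj) gp gq.
  by rewrite eBpq_new //; case: gP.
by rewrite nE; exists h.
Qed.

(** * The dichotomy for all orders *)

Lemma bicyclic_small_or_exceptional (G : sgraph) n : 6 <= n -> connected G -> #|G| = n ->
  degsum G = 2 * n + 2 -> wiener_small G \/ exceptional G n.
Proof.
elim: n G => // n IHn G; rewrite leq_eqVlt => /predU1P[<- Gc G6 GS|n6 Gc Gn GS].
  have [small|ex] := bicyclic6 Gc G6 GS; last by right; left.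
  by left; rewrite /wiener_small G6; lia.
have [v v1|deg2] := pickP (fun v : G => deg v <= 1).
  have {}v1 : deg v = 1 by have := @deg_gt0 _ v Gc; lia.
  have [z vz] := deg1P v1.
  have zv : z != v by apply/eqP => E; have := vz z; rewrite E adj_irr eqxx.
  have [u uE] := undelP zv; rewrite -uE in vz.
  have dn : #|del v| = n by have := card_del v; lia.
  have dS : degsum (del v) = 2 * n + 2 by have := degsum_del v; lia.
  have GS' : degsum G = 2 * #|G| + 2 by rewrite Gn.
  apply: (pendant_step Gc v1 vz dn n6 GS').
  exact: IHn n6 (connected_del_pendant Gc v1) dn dS.
have {}deg2 (x : G) : 2 <= deg x by rewrite ltnNge deg2.
have GS' : degsum G = 2 * #|G| + 2 by rewrite Gn.
have G7 : 7 <= #|G| by rewrite Gn.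
have [small|[v [b [vb nvb tv tb]]]] := triangle_ends_or_small Gc GS' G7 deg2; first by left.
by right; left; constructor 4; rewrite -Gn; apply: two_triangles_shape tv tb.
Qed.

(** * Conclusion *)

Lemma wiener_of_edges n es e D : 0 < n -> (forall i j, i < n -> j < n ->
    e i j = (i != j) && (((i, j) \in es) || ((j, i) \in es))) ->
  metric_on n e D -> 2 * wiener (of_edges n es) = \sum_(i < n) \sum_(j < n) D i j.
Proof.
move=> n0 eE De; have [f fP] := of_edges_shaped eE.
by rewrite (wiener_double (labelled_connected fP De n0)) (labelled_dsum2 fP De).
Qed.

Lemma wiener_B n s : s + 4 <= n -> 2 * wiener (B n s) = \sum_(i < n) \sum_(j < n) DB s i j.
Proof.
move=> sn; apply: wiener_of_edges (metric_B sn); first by lia.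
by move=> i j; apply: eB_edges.
Qed.

Lemma wiener_Bn0 n : 4 <= n -> 6 * wiener (B n 0) + 13 * n = n ^ 3 + 30.
Proof. by move=> n4; have := wiener_B (s := 0) n4; have := total_Bn0 n4; lia. Qed.

Lemma wiener_Bn1 n : 5 <= n -> 6 * wiener (B n 1) + 19 * n = n ^ 3 + 60.
Proof. by move=> n5; have := wiener_B (s := 1) n5; have := total_Bn1 (ltnW n5); lia. Qed.

Lemma wiener_B1 n : 4 <= n -> 6 * wiener (B1 n) + 19 * n = n ^ 3 + 54.
Proof.
move=> n4; have := total_B1 n4.
have <- : 2 * wiener (B1 n) = \sum_(i < n) \sum_(j < n) DB1 i j; last by lia.
apply: wiener_of_edges (metric_B1 n4); first by lia.
by move=> i j; apply: eB1_edges.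
Qed.

Lemma wiener_Bpq n : 5 <= n -> 6 * wiener (Bpq n 3 3) + 13 * n = n ^ 3 + 24.
Proof.
move=> n5; have := total_Bpq n5.
have <- : 2 * wiener (Bpq n 3 3) = \sum_(i < n) \sum_(j < n) DBpq n i j; last by lia.
apply: wiener_of_edges (metric_Bpq n5); first by lia.
by move=> i j; apply: eBpq_edges.
Qed.

Lemma wiener_B82 : wiener (B 8 2) = 69.
Proof.
have := wiener_B (n := 8) (s := 2) isT; rewrite !big_ord_recl !big_ord0.
set t := (X in _ = X); have -> : t = 138 by vm_compute.
by lia.
Qed.

Theorem theorem2p2 (n : nat) (G : sgraph) :
  6 <= n -> #|G| = n -> bicyclic G ->
  ~ iso G (B n 0) -> ~ iso G (B n 1) -> ~ iso G (B1 n) -> ~ iso G (Bpq n 3 3) ->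
  [/\ n = 6 ->
        [/\ wiener G < wiener (B1 6),
            wiener (B1 6) < wiener (B 6 1),
            wiener (B 6 1) = wiener (Bpq 6 3 3)
          & wiener (Bpq 6 3 3) < wiener (B 6 0)],
      n = 8 -> ~ iso G (B 8 2) ->
        [/\ wiener G < wiener (B 8 2),
            wiener (B 8 2) = wiener (B1 8),
            wiener (B1 8) < wiener (B 8 1),
            wiener (B 8 1) < wiener (Bpq 8 3 3)
          & wiener (Bpq 8 3 3) < wiener (B 8 0)]
    & 7 <= n -> n <> 8 ->
        [/\ wiener G < wiener (B1 n),
            wiener (B1 n) < wiener (B n 1),
            wiener (B n 1) < wiener (Bpq n 3 3)
          & wiener (Bpq n 3 3) < wiener (B n 0)]].
Proof.
move=> n6 Gn [Gc GE] notB0 notB1s notB1 notBpq.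
have GS : degsum G = 2 * n + 2 by rewrite degsum_edges GE Gn mulnDr.
have isoB s : s + 4 <= n -> shaped G n (eB s) -> iso G (B n s).
  by move=> sn [f fP]; apply: (labelled_iso fP) => i j; apply: eB_edges.
have small : n = 8 /\ iso G (B 8 2) \/ 6 * wiener G + 19 * n <= n ^ 3 + 48.
  have [|[[]|[n8 GB]]] := bicyclic_small_or_exceptional n6 Gc Gn GS.
  - by rewrite /wiener_small Gn -(wiener_double Gc); right; lia.
  - by move/(isoB 0 (ltnW (ltnW n6))).
  - by move/(isoB 1 (ltnW n6)).
  - case=> f fP; case: notB1; apply: (labelled_iso fP) => i j.
    by apply: eB1_edges; apply: ltnW (ltnW n6).
  - case=> f fP; case: notBpq; apply: (labelled_iso fP) => i j.
    by apply: eBpq_edges; apply: ltnW.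
  - by left; split=> //; rewrite n8 in isoB; apply: isoB.
(* For B_n^{(1)}, B(n,1), B_n^{3,3}, B(n,0) the value of 6W is n^3 - 19n + 54, n^3 - 19n + 60, n^3 -
   13n + 24, n^3 - 13n + 30. The first is 6 thr(n) + 6, and the middle two compare as 36 with 6n,
   hence are equal at n = 6 only. *)
have W0 := wiener_Bn0 (ltnW (ltnW n6)); have W1s := wiener_Bn1 (ltnW n6).
have W1 := wiener_B1 (ltnW (ltnW n6)); have Wpq := wiener_Bpq (ltnW n6).
split=> [nE|nE notB82|n7 n8].
- rewrite nE in small W0 W1s W1 Wpq.
  by case: small => [[]|small] //; split; lia.
- rewrite nE in small W0 W1s W1 Wpq; rewrite wiener_B82.
  by case: small => [[_] //|small]; split; lia.
- by case: small => [[]|small] //; split; lia.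
Qed.
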